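(* Let $\phi=(1+\sqrt5)/2$ and let $F_i$ be the Fibonacci numbers with $F_{-1}=1$, $F_0=0$, $F_{i+1}=F_i+F_{i-1}$. The value of $\hat\mu(t)$ for $t\in[1,\phi^4]$ is given by $$\hat\mu(t)=\begin{cases}\dfrac{F_{i-2}}{F_i}\,t & \text{if } t\in\left[\dfrac{F_i^2}{F_{i-2}^2},\dfrac{F_{i+2}}{F_{i-2}}\right],\\[2mm] \dfrac{F_{i+2}}{F_i} & \text{if } t\in\left[\dfrac{F_{i+2}}{F_{i-2}},\dfrac{F_{i+2}^2}{F_i^2}\right],\end{cases}$$ where $i\ge1$ takes all odd values. For $t\in[\phi^4,7+1/9]$, $$\hat\mu(t)=\begin{cases}\dfrac{1+t}{3} & \text{if } t\in[\phi^4,7],\\[2mm] \dfrac83 & \text{if } t\in[7,7+1/9].\end{cases}$$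
   Context: We work over $\mathbb{C}$. For $\xi\in\mathbb{C}[[x]]$ with $\xi(0)=0$ and real $t\ge 1$, the quasimonomial valuation $v(\xi,t)$ of $\mathbb{C}(x,y)$ is given on polynomials by $f\mapsto v(\xi,t;f)=\operatorname{ord}_x f(x,\xi(x)+\theta x^t)$, $\theta$ transcendental over $\mathbb{C}$; equivalently, if $f=\sum a_{ij}x^i(y-\xi(x))^j$, then $v(\xi,t;f)=\min\{i+tj\mid a_{ij}\ne0\}$. Put $\mu_d(\xi,t)=\max\{v(\xi,t;f)\mid 0\ne f\in\mathbb{C}[x,y],\ \deg f\le d\}$ and $\hat\mu(\xi,t)=\lim_{d\to\infty}\mu_d(\xi,t)/d$. The function $t\mapsto\hat\mu(\xi,t)$ on $[1,\infty)$ is the same for all very general $\xi$ (coefficients outside a countable union of proper Zariski closed conditions on jets), and for each $t$ its value is the minimum over all $\xi$; it is denoted $\hat\mu(t)$. *)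

(* Defs.v *)
From HB Require Import structures.
From mathcomp Require Import all_boot all_order all_algebra.
From mathcomp Require Import complex.
From mathcomp Require mpoly.
From mathcomp Require Import boolp classical_sets reals topology normedtype sequences.
Set Implicit Arguments.
Unset Strict Implicit.
Unset Printing Implicit Defensive.
Import Order.TTheory GRing.Theory Num.Theory.
Import numFieldNormedType.Exports.
Local Open Scope classical_set_scope.
Local Open Scope ring_scope.

(* A formal power series in C[[x]], C = R[i], is given by its coefficients:
   xi k is the coefficient of x^k.  A polynomial f in C[x, y] is an element of
   {poly {poly R[i]}} with outer variable y, so that f`_j`_i is the coefficient
   of x^i y^j. *)

(* The coefficient a_ij of x^i (y - xi(x))^j in f, i.e. the coefficient of
   x^i Y^j in f(x, xi(x) + Y); it only depends on xi modulo x^(i+1), so xi can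
   be truncated there. *)
Definition qm_coef (R : realType) (xi : nat -> R[i]) (f : {poly {poly R[i]}})
    (i j : nat) : R[i] :=
  (f \Po ('X + (\poly_(k < i.+1) xi k)%:P))`_j`_i.

(* The infimum is a minimum for f != 0 and t >= 1. *)
Definition qm_val (R : realType) (xi : nat -> R[i]) (t : R)
    (f : {poly {poly R[i]}}) : R :=
  inf [set r | exists i j : nat,
         qm_coef xi f i j != 0 /\ r = i%:R + t * j%:R].

Definition tdeg_le (R : realType) (d : nat) (f : {poly {poly R[i]}}) : Prop :=
  forall i j : nat, f`_j`_i != 0 -> (i + j <= d)%N.

(* The supremum is a maximum: for t >= 1 and xi 0 = 0 the values lie in the
   discrete set N + t N and are at most t * d. *)
Definition mu (R : realType) (d : nat) (xi : nat -> R[i]) (t : R) : R :=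
  sup [set r | exists f : {poly {poly R[i]}},
         [/\ f != 0, tdeg_le d f & r = qm_val xi t f]].

Definition mu_hat_at (R : realType) (xi : nat -> R[i]) (t : R) : R :=
  lim ((fun d : nat => mu d xi t / d%:R) @ \oo).

Definition zariski_closed (R : realType) (n : nat) (Z : set ('I_n -> R[i])) :
    Prop :=
  exists S : set (mpoly.mpoly n R[i]),
    Z = [set a | forall p, S p -> mpoly.meval a p = 0].

(* The n-jet of a series without constant term: the coefficients of
   x, ..., x^n. *)
Definition jet (R : realType) (n : nat) (xi : nat -> R[i]) : 'I_n -> R[i] :=
  fun k => xi k.+1.
Arguments jet {R} n xi k.

Definition very_general (R : realType) (P : (nat -> R[i]) -> Prop) : Prop :=
  exists (n : nat -> nat) (Z : forall k : nat, set ('I_(n k) -> R[i])),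
    (forall k, zariski_closed (Z k) /\ Z k <> setT) /\
    (forall xi : nat -> R[i], xi 0%N = 0 ->
       (forall k, ~ Z k (jet (n k) xi)) -> P xi).

(* The common function t |-> mu_hat_at xi t, t >= 1, of very general xi; its
   values are unique on [1, +oo[ and irrelevant for t < 1. *)
Definition mu_hat (R : realType) : R -> R :=
  get [set g : R -> R | very_general (fun xi : nat -> R[i] =>
         forall t : R, 1 <= t -> mu_hat_at xi t = g t)].

Fixpoint fib (n : nat) : nat :=
  if n is m.+1 then (if m is k.+1 then fib m + fib k else 1)%N else 0%N.

(* Fibonacci numbers with indices in Z; Negz n is - (n + 1), and
   F_(- m) = (-1)^(m + 1) F_m, so that F_(-1) = 1. *)
Definition fibz (i : int) : int :=
  match i with
  | Posz n => (fib n)%:Z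
  | Negz n => (-1) ^+ n * (fib n.+1)%:Z
  end.

(* Main.v *)
From HB Require Import structures.
Require Import Defs.
From mathcomp Require Import all_boot all_order all_algebra all_field.
From mathcomp Require Import complex.
From mathcomp Require mpoly.
From mathcomp Require Import boolp classical_sets functions cardinality.
From mathcomp Require Import constructive_ereal reals topology normedtype.
From mathcomp Require Import sequences measure lebesgue_measure.
From mathcomp Require Import ring lra zify.
Set Implicit Arguments.
Unset Strict Implicit.
Unset Printing Implicit Defensive.
Import Order.TTheory GRing.Theory Num.Theory.
Import numFieldNormedType.Exports.
Import -(notations) mpoly.
Local Open Scope ring_scope.

(** Why the formula holds.  For fixed weights (1, t), a polynomial f has
    valuation at least m when its coefficients at the finitely many x^i Y^j with
    i + t j < m vanish, Y = y - xi(x).  For given positions and a given degree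
    bound, the existence of a nonzero solution is the vanishing of maximal minors
    of a matrix whose entries are polynomials in a jet of xi.  Hence a very general
    xi admits only those solutions that every xi admits ([very_general_generic]);
    such series exist because the complex numbers are uncountable
    ([very_general_nonempty]), and [mu_hat] is computed by any of them.  So
    [mu_hat t = c] follows ([mu_hat_eq]) from two facts of very different nature:
    every xi admits some f of some degree d with valuation at least c d, whose
    powers then do as well in the limit; and for one single xi, which may be as
    special as one likes, no f of degree d has valuation above c d.

    The curves of the first kind exist by counting.  If p q = d^2 + 1 and
    p + q = 3 d, which p, d, q = F_(i-2), F_i, F_(i+2) satisfy for odd i, there are
    fewer lattice points below the segment from (q, 0) to (0, p) than coefficients
    in degree d ([attains_triangle]).  In degree 3, the nine conditions for a node
    with a branch that meets y = xi(x) to order 7 leave a cubic ([attains_cubic]).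

    For the second kind, the valuation is nondecreasing in t and its quotient by t
    is nonincreasing, so for t below phi^4 it is enough to bound it by
    (F_(i+2) / F_i) d at t = F_(i+2)^2 / F_i^2.  Put N = x y z - x^3 - y^3,
    A_(-1) = x, A_1 = y and A_(j-2) A_(j+2) = A_j^3 + N^(F_j) for odd j.  This is a
    generalized cluster mutation: the A_j are polynomials of degree F_j, and any
    two consecutive ones together with N determine x, y and z.  On a curve where
    A_i and A_(i+2) are constant, running the recursion backwards writes x, y, z as
    polynomials in the parameter N, of degree at most F_i F_(i+2)
    ([pencil_member]); at N = oo the curve passes through the node of N = 0, where
    x / z vanishes to order F_i^2 and a branch of the cubic to order F_(i+2)^2
    ([ord_branch]).  Let xi be that branch, up to high order.  These curves sweep
    out the plane, so some member is not contained in f = 0; counting the zeros of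
    f on it gives the bound ([pencil_bound]).

    For t between phi^4 and 7 + 1/9, let xi agree with the branch of the nodal cubic
    to order exactly 7.  If f is not a multiple of N, intersecting f = 0 with both
    branches of the cubic bounds the valuation ([nodal_bezout]); phi^4 and 7 + 1/9
    are where this bound meets (1 + t) / 3 and 8 / 3.  Multiples of N reduce to a
    smaller degree, because N has a single monomial of least weight, so that
    valuations add up ([nodal_growth]). *)

(** * Coefficients along the curve y = xi(x) *)

(** [qm_coef] over any commutative ring, so that the coefficients of xi may also
    be indeterminates. *)
Definition shift_coef (A : comNzRingType) (xi : nat -> A) (f : {poly {poly A}})
    (i j : nat) : A :=
  (f \Po ('X + (\poly_(k < i.+1) xi k)%:P))`_j`_i.

Lemma comp_poly_subr (A : comNzRingType) (p q r : {poly A}) :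
  exists h, (p \Po q) - (p \Po r) = (q - r) * h.
Proof.
elim/poly_ind: p => [|p c [h hE]].
  by exists 0; rewrite !comp_poly0 mulr0 subr0.
exists (h * q + (p \Po r)); rewrite !comp_polyD !comp_polyM !comp_polyX !comp_polyC.
rewrite (_ : p \Po q = (q - r) * h + (p \Po r)); last by rewrite -hE; ring.
ring.
Qed.

Lemma coef_shift_congr (A : comNzRingType) (f : {poly {poly A}})
    (a b : {poly A}) (i j : nat) :
    (forall k, (k <= i)%N -> a`_k = b`_k) ->
  (f \Po ('X + a%:P))`_j`_i = (f \Po ('X + b%:P))`_j`_i.
Proof.
move=> eqab; apply/eqP; rewrite -subr_eq0 -coefB -coefB.
have [h ->] := comp_poly_subr f ('X + a%:P) ('X + b%:P).
rewrite (_ : _ + _ - _ = (a - b)%:P); last by rewrite polyCB; ring.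
rewrite coefCM coefM big1 // => k _.
by rewrite coefB eqab ?subrr ?mul0r // -ltnS.
Qed.

Lemma shift_coefE (A : comNzRingType) (xi : nat -> A) (a : {poly A}) f i j :
    (forall k, (k <= i)%N -> a`_k = xi k) ->
  shift_coef xi f i j = (f \Po ('X + a%:P))`_j`_i.
Proof.
move=> aE; apply: coef_shift_congr => k ki.
by rewrite coef_poly ltnS ki aE.
Qed.

Lemma shift_coef_trunc (A : comNzRingType) (xi : nat -> A) f i j n : (i < n)%N ->
  shift_coef xi f i j = (f \Po ('X + (\poly_(k < n) xi k)%:P))`_j`_i.
Proof.
by move=> lin; apply: shift_coefE => k ki; rewrite coef_poly (leq_ltn_trans ki).
Qed.

Lemma shift_coef_poly (A : comNzRingType) (a : {poly A}) f i j :
  shift_coef (fun k => a`_k) f i j = (f \Po ('X + a%:P))`_j`_i.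
Proof. exact: shift_coefE. Qed.

Lemma eq_shift_coef (A : comNzRingType) (xi xi' : nat -> A) f i j :
  (forall k, (k <= i)%N -> xi k = xi' k) -> shift_coef xi f i j = shift_coef xi' f i j.
Proof.
move=> eqx; apply: shift_coefE => k ki; by rewrite coef_poly ltnS ki -eqx.
Qed.

Lemma shift_coefM (A : comNzRingType) (xi : nat -> A) f g i j :
  shift_coef xi (f * g) i j =
    \sum_(b < j.+1) \sum_(a < i.+1)
      shift_coef xi f a b * shift_coef xi g (i - a) (j - b).
Proof.
rewrite (shift_coef_trunc _ _ _ (ltnSn i)) comp_polyM coefM coef_sum.
apply: eq_bigr => b _; rewrite coefM; apply: eq_bigr => a _.
by rewrite -!shift_coef_trunc // ?ltnS ?leq_subr.
Qed.

Lemma shift_coef1 (A : comNzRingType) (xi : nat -> A) i j :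
  shift_coef xi 1 i j = ((i == 0) && (j == 0))%:R.
Proof.
rewrite /shift_coef comp_polyC coef1; case: (j == 0)%N => /=.
  by rewrite andbT coef1.
by rewrite andbF coef0.
Qed.

Lemma shift_coef_map (A B : comNzRingType) (phi : {rmorphism A -> B})
    (xi : nat -> A) f i j :
  phi (shift_coef xi f i j)
  = shift_coef (fun k => phi (xi k)) (map_poly (map_poly phi) f) i j.
Proof.
rewrite /shift_coef -coef_map -(coef_map (map_poly phi)) /=.
rewrite (map_comp_poly (map_poly phi)) rmorphD /= map_polyX map_polyC /=.
have -> : map_poly phi (\poly_(k < i.+1) xi k) = \poly_(k < i.+1) phi (xi k).
  by apply/polyP => k; rewrite coef_map !coef_poly; case: ifP => _; rewrite ?raddf0.
reflexivity.
Qed.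

Lemma shift_coefD (A : comNzRingType) (xi : nat -> A) f g i j :
  shift_coef xi (f + g) i j = shift_coef xi f i j + shift_coef xi g i j.
Proof. by rewrite /shift_coef comp_polyD !coefD. Qed.

Lemma shift_coef_sum (A : comNzRingType) (xi : nat -> A) i j (I : Type) (r : seq I)
    (c : I -> A) (F : I -> {poly {poly A}}) :
  shift_coef xi (\sum_(k <- r) (c k)%:P *: F k) i j
  = \sum_(k <- r) c k * shift_coef xi (F k) i j.
Proof.
elim: r => [|k r IH]; first by rewrite !big_nil /shift_coef comp_poly0 !coef0.
rewrite !big_cons shift_coefD IH; congr (_ + _).
by rewrite /shift_coef comp_polyZ coefZ coefCM.
Qed.

(** The substitution y := y + xi(x) fixes the leading coefficient in y, so a
    coefficient survives although each one is computed with its own truncation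
    of xi. *)
Lemma shift_coef_neq0 (A : idomainType) (xi : nat -> A) f :
  f != 0 -> exists i j, shift_coef xi f i j != 0.
Proof.
move=> f0; have lf : lead_coef f != 0 by rewrite lead_coef_eq0.
exists (size (lead_coef f)).-1, (size f).-1.
set i := _.-1.
rewrite (shift_coef_trunc _ _ _ (ltnSn i)).
set q := 'X + _; have sq : size q = 2%N by rewrite size_XaddC.
have : lead_coef (f \Po q) = lead_coef f.
  rewrite lead_coef_comp ?sq // (_ : lead_coef q = 1) ?expr1n ?mulr1 //.
  by rewrite /q lead_coefXaddC.
rewrite {1}lead_coefE size_comp_poly2 // => ->.
by rewrite -[_`_i]lead_coefE lead_coef_eq0.
Qed.

(** * Linear conditions on polynomials of bounded degree *)

Definition tdeg (A : nzRingType) (d : nat) (f : {poly {poly A}}) : Prop :=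
  forall i j : nat, f`_j`_i != 0 -> (i + j <= d)%N.

Definition monomials (d : nat) : seq (nat * nat) :=
  [seq (i, j) | j <- iota 0 d.+1, i <- iota 0 (d.+1 - j)].

Lemma mem_monomials d i j : ((i, j) \in monomials d) = (i + j <= d)%N.
Proof.
apply/allpairsPdep/idP => [[j' [i' [+ + [-> ->]]]]|ijd].
  by rewrite !mem_iota; lia.
by exists j, i; rewrite !mem_iota; split=> //; lia.
Qed.

Lemma uniq_monomials d : uniq (monomials d).
Proof.
apply: allpairs_uniq_dep => [|j _|[j i] [j' i'] _ _ /= [-> ->]//]; exact: iota_uniq.
Qed.

Lemma size_monomials d : (2 * size (monomials d) = d.+1 * d.+2)%N.
Proof.
rewrite size_allpairs_dep (eq_map (g := fun j => (d.+1 - j)%N)); last first.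
  by move=> j; rewrite size_iota.
have H n : sumn [seq (n - j)%N | j <- iota 0 n] = (\sum_(j < n) j.+1)%N.
  rewrite sumnE big_map (_ : iota 0 n = index_iota 0 n) ?big_mkord; last first.
    by rewrite /index_iota subn0.
  rewrite (reindex_inj rev_ord_inj) /=; apply: eq_bigr => j _.
  by have := ltn_ord j; lia.
rewrite H; elim: d.+1 => [|n IH]; first by rewrite big_ord0.
by rewrite big_ord_recr /= mulnDr IH; lia.
Qed.

Definition monomial (A : nzRingType) (m : nat * nat) : {poly {poly A}} :=
  ('X^(m.1))%:P * 'X^(m.2).

Lemma coef_monomial (A : nzRingType) m i j : (monomial A m)`_j`_i = ((i, j) == m)%:R.
Proof.
rewrite /monomial coefCM coefXn; case: m => a b; rewrite xpair_eqE /=.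
case: (j == b); last by rewrite andbF mulr0 coef0.
by rewrite andbT mulr1 coefXn.
Qed.

Definition form_of (A : nzRingType) d (u : 'rV[A]_(size (monomials d))) :=
  \sum_k (u 0 k)%:P *: monomial A (nth (0%N, 0%N) (monomials d) k).

Lemma coef_form_of (A : nzRingType) d (u : 'rV[A]_(size (monomials d)))
    (k : 'I_(size (monomials d))) :
  let m := nth (0%N, 0%N) (monomials d) k in
  (form_of u)`_m.2`_m.1 = u 0 k.
Proof.
move=> m; rewrite /form_of !coef_sum (bigD1 k) //= big1 ?addr0 => [|l lk].
  by rewrite coefZ coefCM coef_monomial -surjective_pairing eqxx mulr1.
rewrite coefZ coefCM coef_monomial -surjective_pairing nth_uniq ?uniq_monomials //.
by rewrite (negPf (_ : k != l :> nat)) ?mulr0 // eq_sym.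
Qed.

Lemma form_of_tdeg (A : nzRingType) d (u : 'rV[A]_(size (monomials d))) :
  tdeg d (form_of u).
Proof.
move=> i j; apply: contraNT; rewrite -ltnNge => dij.
rewrite /form_of !coef_sum big1 // => k _; rewrite coefZ coefCM coef_monomial.
case: eqP => [ijE|]; last by rewrite mulr0.
have : nth (0, 0)%N (monomials d) k \in monomials d by rewrite mem_nth.
by rewrite -ijE mem_monomials leqNgt dij.
Qed.

Lemma form_ofP (A : nzRingType) d (f : {poly {poly A}}) : tdeg d f ->
  exists u, f = form_of (d := d) u.
Proof.
move=> fd.
exists (\row_k f`_(nth (0, 0)%N (monomials d) k).2`_(nth (0, 0)%N (monomials d) k).1).
set u := \row_k _; apply/polyP => j; apply/polyP => i.
have [ijd|dij] := leqP (i + j) d.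
  have ijm : (i, j) \in monomials d by rewrite mem_monomials.
  have kl : (index (i, j) (monomials d) < size (monomials d))%N by rewrite index_mem.
  by have := coef_form_of u (Ordinal kl); rewrite mxE /= nth_index // => ->.
transitivity (0 : A).
  by apply/eqP; apply: contraTT dij => /fd; rewrite -leqNgt.
by apply/esym/eqP; apply: contraTT dij => /form_of_tdeg; rewrite -leqNgt.
Qed.

Definition cond_mx (A : comNzRingType) (xi : nat -> A) d (S : seq (nat * nat)) :
    'M[A]_(size (monomials d), size S) :=
  \matrix_(k, l) let m := nth (0%N, 0%N) S l in
    shift_coef xi (monomial A (nth (0%N, 0%N) (monomials d) k)) m.1 m.2.

Lemma cond_mx_map (A B : comNzRingType) (phi : {rmorphism A -> B}) xi d S :
  map_mx phi (cond_mx xi d S) = cond_mx (fun k => phi (xi k)) d S.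
Proof.
apply/matrixP => k l; rewrite !mxE /= shift_coef_map; congr (shift_coef _ _ _ _).
by rewrite /monomial rmorphM /= map_polyC /= !map_polyXn.
Qed.

Lemma mul_cond_mx (A : comNzRingType) (xi : nat -> A) d S u (l : 'I_(size S)) :
  let m := nth (0%N, 0%N) S l in
  (u *m cond_mx xi d S) 0 l = shift_coef xi (form_of u) m.1 m.2.
Proof.
by rewrite !mxE /= shift_coef_sum; apply: eq_bigr => k _; rewrite mxE.
Qed.

(** The system of linear conditions behind [mu]: S lists the positions where the
    coefficients have to vanish. *)
Definition vanishing (A : comNzRingType) (d : nat) (S : seq (nat * nat))
    (xi : nat -> A) : Prop :=
  exists f : {poly {poly A}},
    [/\ f != 0, tdeg d f & forall m, m \in S -> shift_coef xi f m.1 m.2 = 0].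

Lemma vanishingP (F : fieldType) d S (xi : nat -> F) :
  vanishing d S xi <-> ~~ row_free (cond_mx xi d S).
Proof.
split=> [[f [f0 fd fS]]|].
  have [u fE] := form_ofP fd; apply/negP => free.
  have u0 : u *m cond_mx xi d S = 0.
    apply/rowP => l; rewrite mul_cond_mx -fE fS ?mxE //.
    by rewrite mem_nth.
  move/eqP: f0; apply; rewrite fE.
  have -> : u = 0 by apply: (row_free_inj free); rewrite u0 mul0mx.
  by rewrite /form_of big1 // => k _; rewrite mxE scale0r.
move=> nfree.
have [u [u0 uM]] : exists u : 'rV_(size (monomials d)),
    u != 0 /\ u *m cond_mx xi d S = 0.
  move: nfree; rewrite -kermx_eq0 => /rowV0Pn [u uK u0]; exists u; split=> //.
  by apply/sub_kermxP.
exists (form_of u); split.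
- have /matrix0Pn [z [k uk]] := u0.
  apply: contraNneq uk => fu0; rewrite (ord1 z).
  by rewrite -(coef_form_of u k) fu0 !coef0.
- exact: form_of_tdeg.
- move=> m mS.
  have kl : (index m S < size S)%N by rewrite index_mem.
  by have := mul_cond_mx xi u (Ordinal kl); rewrite uM mxE /= nth_index // => <-.
Qed.

(** A linear system with fewer equations than unknowns has a nonzero solution;
    [d.+1 * d.+2] is twice the number of unknowns. *)
Lemma vanishing_few (F : fieldType) d S (xi : nat -> F) :
  (2 * size S < d.+1 * d.+2)%N -> vanishing d S xi.
Proof.
move=> Sd; apply/vanishingP; apply/negP => /eqP rk.
have := rank_leq_col (cond_mx xi d S); rewrite rk; have := size_monomials d; lia.
Qed.

(** This form of the condition is visibly Zariski closed in xi, since minors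
    commute with ring morphisms. *)
Lemma vanishing_minors (F : fieldType) d S (xi : nat -> F) :
  vanishing d S xi <->
  forall g : {ffun 'I_(size (monomials d)) -> 'I_(size S)},
    \det (colsub g (cond_mx xi d S)) = 0.
Proof.
rewrite vanishingP; split=> [nfree g|minors].
  apply/eqP; apply: contraNT nfree => dg.
  have : colsub g (cond_mx xi d S) \in unitmx by rewrite unitmxE unitfE.
  rewrite -row_free_unit -!row_leq_rank => /leq_trans; apply.
  by rewrite -{1}[cond_mx _ _ _]mulmx1 -mulmx_colsub mxrankM_maxl.
apply/negP => free.
have full : row_full (cond_mx xi d S)^T by rewrite /row_full mxrank_tr.
have := fullrowsub_unit full; rewrite unitmxE unitfE -det_tr.
by rewrite trmx_mxsub trmxK minors eqxx.
Qed.

(** * Very general series *)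

Section VeryGeneral.
Local Open Scope classical_set_scope.
Local Open Scope ring_scope.

Lemma uncountable_reals (R : realType) : ~ countable [set: R].
Proof.
move=> /countable_lebesgue_measure0.
rewrite -set_itvNyy lebesgue_measure_itv /= => /eqP.
by [].
Qed.

(** Countably many polynomials have countably many roots, but there are
    uncountably many real numbers. *)
Lemma avoid_roots (R : realType) (q : nat -> {poly R[i]}) :
  (forall k, q k != 0) -> exists c : R[i], forall k, (q k).[c] != 0.
Proof.
move=> q0; apply: contrapT => no.
apply: (@uncountable_reals R).
have -> : [set: R] = \bigcup_k [set r : R | root (q k) r%:C%C].
  apply/seteqP; split=> // r _.
  apply: contrapT => nr; apply: no; exists (r%:C)%C => k; apply/negP => rk.
  by apply: nr; exists k.
apply: bigcup_countable; first exact: countableP.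
move=> k _; apply: finite_set_countable.
have [rs rsE] := closed_field_poly_normal (q k).
apply: (@sub_finite_set _ _ [set` [seq complex.Re z | z <- rs]]).
  move=> r /=; rewrite rsE rootZ ?lead_coef_eq0 ?q0 // root_prod_XsubC => rin.
  by apply/mapP; exists (r%:C)%C.
exact: finite_seq.
Qed.

Definition upd (T : Type) (xi : nat -> T) (m : nat) (c : T) : nat -> T :=
  fun k => if k == m then c else xi k.

Lemma meval_upd (R : realType) n (p : mpoly n R[i]) (xi : nat -> R[i]) m :
  exists q : {poly R[i]}, forall c, meval (jet n (upd xi m c)) p = q.[c].
Proof.
exists (\sum_(u <- msupp p) (mcoeff u p)%:P *
   \prod_(i < n) (if i.+1 == m then 'X else (xi i.+1)%:P) ^+ (fun_of_multinom u i)).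
move=> c; rewrite mevalE horner_sum; apply: eq_bigr => u _.
rewrite hornerM hornerC horner_prod; congr (_ * _); apply: eq_bigr => i _.
by rewrite horner_exp /jet /upd; case: ifP; rewrite ?hornerX ?hornerC.
Qed.

Section Avoid.
Variables (R : realType) (n : nat -> nat) (p : forall k, mpoly (n k) R[i]).

(** The invariant of a construction of xi one coefficient at a time: no p k
    vanishes identically once the first m coefficients of xi have been fixed. *)
Definition extendable (m : nat) (xi : nat -> R[i]) : Prop :=
  forall k, exists xi', (forall l, (l <= m)%N -> xi' l = xi l) /\
    meval (jet (n k) xi') (p k) != 0.

(** Freeze all later coefficients at a witness for p k: what remains is a nonzero
    polynomial in the next coefficient, one for each k. *)
Lemma extendable_step m xi : extendable m xi ->
  exists c, extendable m.+1 (upd xi m.+1 c).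
Proof.
move=> ext; have /choice[xi' xi'P] := ext.
have /choice[q qE] : forall k, exists q : {poly R[i]},
    forall c, meval (jet (n k) (upd (xi' k) m.+1 c)) (p k) = q.[c].
  by move=> k; exact: meval_upd.
have [|c cP] := @avoid_roots R q.
  move=> k; have [_] := xi'P k; apply: contraNneq => qk0.
  have <- : upd (xi' k) m.+1 (xi' k m.+1) = xi' k.
    by apply/funext => l; rewrite /upd; case: eqP => [->|].
  by rewrite qE qk0 horner0.
exists c => k; exists (upd (xi' k) m.+1 c); rewrite qE; split=> // l.
rewrite /upd; case: eqP => // lm lm1; apply: (xi'P k).1; lia.
Qed.

Lemma extendable_all xi0 : extendable 0 xi0 ->
  exists xi, xi 0%N = xi0 0%N /\ forall k, meval (jet (n k) xi) (p k) != 0.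
Proof.
move=> ext0.
pose step m (s : {xi | extendable m xi}) : {xi | extendable m.+1 xi} :=
  let: exist c cP := cid (extendable_step (proj2_sig s)) in exist _ _ cP.
pose s := fix s m : {xi | extendable m xi} :=
  if m is m'.+1 then step m' (s m') else exist _ xi0 ext0.
have sS m l : (l <= m)%N -> sval (s m.+1) l = sval (s m) l.
  move=> lm /=; rewrite /step; case: cid => c cP /=; rewrite /upd.
  by rewrite ltn_eqF.
have sE m l : (l <= m)%N -> sval (s m) l = sval (s l) l.
  elim: m => [|m IH]; first by rewrite leqn0 => /eqP ->.
  by rewrite leq_eqVlt => /predU1P[-> //|]; rewrite ltnS => lm; rewrite sS ?IH.
exists (fun l => sval (s l) l); split=> // k.
have [xi' [xi'E]] := proj2_sig (s (n k)) k.
rewrite (_ : jet _ xi' = jet (n k) (fun l => sval (s l) l)) //.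
by apply/funext => i; rewrite /jet xi'E -?(sE (n k)) ?ltn_ord.
Qed.
End Avoid.

Definition series_of (A : nzRingType) n (a : 'I_n -> A) : nat -> A :=
  fun k => if k is k'.+1 then (if insub k' is Some l then a l else 0) else 0.

Lemma jet_series_of (R : realType) n (a : 'I_n -> R[i]) :
  jet n (series_of a) = a.
Proof. by apply/funext => i; rewrite /jet /series_of /= valK. Qed.

Lemma series_of_jet (R : realType) n (xi : nat -> R[i]) k : xi 0%N = 0 ->
  (k <= n)%N -> series_of (jet n xi) k = xi k.
Proof. by case: k => [|k] // _ kn; rewrite /series_of insubT. Qed.

(** A proper closed set lies in the zero locus of a single nonzero polynomial, and
    countably many of these can be avoided coefficient by coefficient. *)
Lemma very_general_nonempty (R : realType) (P : (nat -> R[i]) -> Prop) :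
  very_general P -> exists xi, xi 0%N = 0 /\ P xi.
Proof.
move=> [n [Z [Zcl ZP]]].
have exap : forall k, exists ap : ('I_(n k) -> R[i]) * mpoly (n k) R[i],
    meval ap.1 ap.2 != 0 /\ (forall b, Z k b -> meval b ap.2 = 0).
  move=> k; have [[S ZE] ZT] := Zcl k.
  apply: contrapT => no; apply: ZT; apply/seteqP; split=> // a _.
  rewrite ZE => p Sp /=; apply: contrapT => pa; apply: no; exists (a, p).
  split; first exact/eqP.
  by move=> b; rewrite ZE; apply.
pose a k := sval (cid (exap k)); have aP k := svalP (cid (exap k)).
have [|xi [xi0 xiP]] := @extendable_all R n (fun k => (a k).2) (fun=> 0).
  move=> k; exists (series_of (a k).1); rewrite jet_series_of; split=> [l|].
    by rewrite leqn0 => /eqP ->.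
  by case: (aP k).
exists xi; split=> //; apply: ZP => // k /(aP k).2 zk.
by have := xiP k; rewrite zk eqxx.
Qed.

Lemma very_general_countable (R : realType) (T : countType)
    (Z : T -> {n & set ('I_n -> R[i])}) (P : (nat -> R[i]) -> Prop) :
    (forall x, zariski_closed (projT2 (Z x)) /\ projT2 (Z x) <> setT) ->
    (forall xi, xi 0%N = 0 ->
       (forall x, ~ projT2 (Z x) (jet (projT1 (Z x)) xi)) -> P xi) ->
  very_general P.
Proof.
move=> Zcl ZP.
pose Z' k := if unpickle k is Some x then Z x else existT _ 0%N set0.
exists (fun k => projT1 (Z' k)), (fun k => projT2 (Z' k)); split.
  (* Unused codes are given the empty set, the zero locus of 1. *)
  move=> k; rewrite /Z'; case: unpickle => [x|] //=; split.
    exists [set 1]; apply/seteqP; split=> // a /(_ 1 erefl) /eqP.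
    by rewrite meval1 oner_eq0.
  by move=> /seteqP[_] /(_ (fun=> 0) I).
move=> xi xi0 xiP; apply: ZP => // x.
by have := xiP (pickle x); rewrite /Z' pickleK.
Qed.

Lemma very_generalS (R : realType) (P Q : (nat -> R[i]) -> Prop) :
  (forall xi, xi 0%N = 0 -> P xi -> Q xi) -> very_general P -> very_general Q.
Proof.
move=> PQ [n [Z [Zcl ZP]]]; exists n, Z; split; first exact: Zcl.
by move=> xi xi0 /(ZP xi xi0); exact: PQ.
Qed.

Lemma very_generalI (R : realType) (P Q : (nat -> R[i]) -> Prop) :
  very_general P -> very_general Q -> very_general (fun xi => P xi /\ Q xi).
Proof.
move=> [n1 [Z1 [cl1 P1]]] [n2 [Z2 [cl2 P2]]].
apply: (@very_general_countable R (nat + nat)%type (fun x => match x with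
  | inl k => existT _ (n1 k) (Z1 k) | inr k => existT _ (n2 k) (Z2 k) end)).
  by case.
move=> xi xi0 xiP; split.
  by apply: P1 => // k; apply: (xiP (inl k)).
by apply: P2 => // k; apply: (xiP (inr k)).
Qed.

(** Only the existence of solutions is compared, not the solutions themselves;
    this is all that [mu] depends on. *)
Definition generic (R : realType) (xi : nat -> R[i]) : Prop :=
  forall d S, vanishing d S xi ->
    forall xi' : nat -> R[i], xi' 0%N = 0 -> vanishing d S xi'.

Lemma eq_vanishing (A : comNzRingType) d S (xi xi' : nat -> A) n :
    (forall m, m \in S -> (m.1 <= n)%N) ->
    (forall k, (k <= n)%N -> xi k = xi' k) ->
  vanishing d S xi -> vanishing d S xi'.
Proof.
move=> Sn eqx [f [f0 fd fS]]; exists f; split=> // m mS.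
rewrite -(fS m mS); apply: eq_shift_coef => k km.
by rewrite eqx // (leq_trans km) ?Sn.
Qed.

Lemma vanishing_closed (R : realType) d S n :
  zariski_closed [set a : 'I_n -> R[i] | vanishing d S (series_of a)].
Proof.
(* The matrix of conditions for the series with indeterminate coefficients. *)
pose M := cond_mx (series_of (fun i : 'I_n => mpolyX R[i] (mnm1 i))) d S.
exists [set p | exists g : {ffun _ -> _}, p = \det (colsub g M)].
have ME (a : 'I_n -> R[i]) : map_mx (meval a) M = cond_mx (series_of a) d S.
  rewrite cond_mx_map; congr (cond_mx _ d S); apply/funext => -[|k] /=.
    exact: raddf0.
  by case: insub => [l|] /=; [exact: mevalXU|exact: raddf0].
apply/seteqP; split=> a /=.
  move=> /vanishing_minors va p [g ->].
  by rewrite -det_map_mx -(va g) -ME map_mxsub.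
move=> va; apply/vanishing_minors => g.
by rewrite -ME -map_mxsub det_map_mx; apply: va; exists g.
Qed.

(** Systems that are solvable for every xi impose nothing; each other system gives
    a proper closed set of jets, and there are countably many systems. *)
Lemma very_general_generic (R : realType) : very_general (@generic R).
Proof.
pose bd (S : seq (nat * nat)) := \max_(m <- S) m.1.
have bdP S m : m \in S -> (m.1 <= bd S)%N.
  by move=> mS; rewrite /bd (big_rem m) //= leq_maxl.
pose Z (x : nat * seq (nat * nat)) : {n & set ('I_n -> R[i])} :=
  if pselect (forall xi : nat -> R[i], xi 0%N = 0 -> vanishing x.1 x.2 xi) then
    existT _ 0%N set0
  else existT _ (bd x.2)
         [set a : 'I_(bd x.2) -> R[i] | vanishing x.1 x.2 (series_of a)].
apply: (@very_general_countable R _ Z) => [[d S]|xi xi0 xiP d S vxi xi' xi'0].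
  rewrite /Z; case: pselect => [_|no] /=; split.
  - exists [set 1]; apply/seteqP; split=> // a /(_ 1 erefl) /eqP.
    by rewrite meval1 oner_eq0.
  - by move=> /seteqP[_] /(_ (fun=> 0) I).
  - exact: vanishing_closed.
  - move=> /seteqP[_ all]; apply: no => xi xi0.
    apply: eq_vanishing (all (jet _ xi) I); first exact: bdP.
    by move=> k kn; rewrite series_of_jet.
have := xiP (d, S); rewrite /Z; case: pselect => /= [all _|_ []]; first exact: all.
by apply: eq_vanishing vxi => [|k kn]; [exact: bdP|rewrite series_of_jet].
Qed.

End VeryGeneral.

(** * From one series to the very general one *)

Section Reduction.
Local Open Scope classical_set_scope.
Local Open Scope ring_scope.

Lemma qm_val_le (R : realType) (xi : nat -> R[i]) (t : R) f i j : 0 <= t ->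
  shift_coef xi f i j != 0 -> qm_val xi t f <= i%:R + t * j%:R.
Proof.
move=> t0 fij; apply: ge_inf; last by exists i, j.
by exists 0 => _ [i' [j' [_ ->]]]; rewrite addr_ge0 ?mulr_ge0.
Qed.

Lemma qm_val_ge (R : realType) (xi : nat -> R[i]) (t m : R) f : f != 0 ->
  (forall i j, shift_coef xi f i j != 0 -> m <= i%:R + t * j%:R) ->
  m <= qm_val xi t f.
Proof.
move=> f0 fm; apply: lb_le_inf.
  by have [i [j fij]] := shift_coef_neq0 xi f0; exists (i%:R + t * j%:R), i, j.
by move=> _ [i [j [fij ->]]]; exact: fm.
Qed.

(** Valuations on a generic series are matched on any other series: if f has
    valuation v for xi, the conditions at the positions of weight below v, a finite
    set as t >= 1, are also solvable for xi'. *)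
Lemma generic_transfer (R : realType) (xi xi' : nat -> R[i]) (t : R) d f :
    generic xi -> xi' 0%N = 0 -> 1 <= t -> f != 0 -> tdeg d f ->
  exists f', [/\ f' != 0, tdeg d f' &
    forall i j, shift_coef xi' f' i j != 0 -> qm_val xi t f <= i%:R + t * j%:R].
Proof.
move=> gen xi'0 t1 f0 fd.
have t0 : 0 <= t by lra.
set v := qm_val xi t f.
pose B := (Num.truncn v).+1.
have vB : v < B%:R by exact: truncnS_gt.
pose S := [seq m <- [seq (i, j) | i <- iota 0 B, j <- iota 0 B] |
           m.1%:R + t * m.2%:R < v].
have SP i j : ((i, j) \in S) = (i%:R + t * j%:R < v).
  rewrite mem_filter -[X in X && _]/(i%:R + t * j%:R < v).
  case: ltP => // ijv; rewrite andTb.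
  have i0 : 0 <= i%:R :> R by [].
  have j0 : 0 <= j%:R :> R by [].
  have tj : j%:R <= t * j%:R by rewrite ler_peMl.
  apply/allpairsPdep; exists i, j; rewrite !mem_iota !add0n /= -!(ltr_nat R).
  by split=> //; lra.
have [|f' [f'0 f'd f'S]] := gen d S _ xi' xi'0.
  exists f; split=> // -[i j]; rewrite SP /= => ijv.
  by apply/eqP; apply: contraTT ijv => fij; rewrite -leNgt qm_val_le.
exists f'; split=> // i j; apply: contraNT; rewrite -ltNge -SP => ijS.
by rewrite (f'S (i, j)).
Qed.

(** Two generic series dominate each other, so the suprema agree, whether or not
    they are attained. *)
Lemma mu_generic (R : realType) (xi xi' : nat -> R[i]) (t : R) d :
    generic xi -> xi 0%N = 0 -> generic xi' -> xi' 0%N = 0 -> 1 <= t ->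
  mu d xi t = mu d xi' t.
Proof.
move=> gen xi0 gen' xi'0 t1.
have sub (xi1 xi2 : nat -> R[i]) : generic xi1 -> xi2 0%N = 0 ->
    down [set r | exists f, [/\ f != 0, tdeg_le d f & r = qm_val xi1 t f]]
    `<=` down [set r | exists f, [/\ f != 0, tdeg_le d f & r = qm_val xi2 t f]].
  move=> g1 x2 r /downP[_ [f [f0 fd ->]] rf].
  have [f' [f'0 f'd f'v]] := generic_transfer g1 x2 t1 f0 fd.
  apply/downP; exists (qm_val xi2 t f'); first by exists f'.
  by apply: le_trans rf _; exact: qm_val_ge.
rewrite /mu; set A := (X in sup X = _); set B := (X in _ = sup X).
have AB : down A = down B by apply/seteqP; split; exact: sub.
exact: etrans (esym (sup_down A)) (etrans (congr1 sup AB) (sup_down B)).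
Qed.

(** The choice in [mu_hat] is meaningful because [mu_hat_at] at one generic
    series is a possible value; the chosen function and the growth rate of a
    generic series then agree at any series in the intersection of the two very
    general sets. *)
Lemma mu_hat_generic (R : realType) : exists xi : nat -> R[i],
  [/\ xi 0%N = 0, generic xi & forall t : R, 1 <= t -> mu_hat t = mu_hat_at xi t].
Proof.
have [xi0 [xi00 gen0]] := very_general_nonempty (@very_general_generic R).
have : very_general (fun xi : nat -> R[i] =>
    forall t, 1 <= t -> mu_hat_at xi t = mu_hat t).
  apply: (@getPex _ [set g : R -> R | very_general (fun xi : nat -> R[i] =>
         forall t : R, 1 <= t -> mu_hat_at xi t = g t)]).
  exists (mu_hat_at xi0).
  apply: very_generalS (very_general_generic R) => xi1 xi10 gen1 t t1.
  have mE d : mu d xi1 t = mu d xi0 t.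
    exact: mu_generic gen1 xi10 gen0 xi00 t1.
  have E : (fun d => mu d xi1 t / d%:R) = (fun d => mu d xi0 t / d%:R).
    by apply/funext => d; rewrite mE.
  exact: (congr1 (fun u : nat -> R => lim (u @ \oo)) E).
move=> /(very_generalI (@very_general_generic R)) /very_general_nonempty.
by move=> [xi [xi_0 [gen xiP]]]; exists xi; split=> // t /xiP ->.
Qed.

(** [growth_le xi t c] bounds valuations by c times the degree.  The bound is
    witnessed by a monomial, which makes it transparent how it varies with t. *)
Definition growth_le (R : realType) (xi : nat -> R[i]) (t c : R) : Prop :=
  forall d f, f != 0 -> tdeg d f ->
  exists i j, shift_coef xi f i j != 0 /\ i%:R + t * j%:R <= c * d%:R.

Definition attains (R : realType) (xi : nat -> R[i]) (t m : R) d : Prop :=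
  exists f, [/\ f != 0, tdeg d f &
    forall i j, shift_coef xi f i j != 0 -> m <= i%:R + t * j%:R].

Lemma mu_le (R : realType) (xi xi' : nat -> R[i]) (t c : R) d :
    generic xi -> xi' 0%N = 0 -> 1 <= t -> growth_le xi' t c ->
  forall f, f != 0 -> tdeg d f -> qm_val xi t f <= c * d%:R.
Proof.
move=> gen xi'0 t1 gr f f0 fd.
have [f' [f'0 f'd f'v]] := generic_transfer gen xi'0 t1 f0 fd.
have [i [j [/f'v vij]]] := gr d f' f'0 f'd; exact: le_trans.
Qed.

Lemma tdeg1 (A : nzRingType) d : tdeg d (1 : {poly {poly A}}).
Proof.
move=> i j; rewrite coef1; case: j => [|j]; last by rewrite coef0 eqxx.
by rewrite coef1; case: i => [|i] //; rewrite mulr0n eqxx.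
Qed.

Lemma tdegM (A : nzRingType) d e (f g : {poly {poly A}}) :
  tdeg d f -> tdeg e g -> tdeg (d + e) (f * g).
Proof.
move=> fd ge i j; apply: contraNT; rewrite -ltnNge => ij.
rewrite coefM coef_sum big1 // => b _; rewrite coefM big1 // => a _.
have [-> | /fd abd] := eqVneq (f`_b`_a) 0; first by rewrite mul0r.
have [-> | /ge abe] := eqVneq (g`_(j - b)`_(i - a)) 0; first by rewrite mulr0.
by move: abd abe (ltn_ord a) (ltn_ord b); lia.
Qed.

Lemma attainsX (R : realType) (xi : nat -> R[i]) (t m : R) d k :
  attains xi t m d -> attains xi t (m * k%:R) (d * k).
Proof.
move=> [f [f0 fd fm]]; exists (f ^+ k); split; first by rewrite expf_neq0.
  elim: k => [|k IH]; last by rewrite exprS mulnS; exact: tdegM.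
  by rewrite expr0; exact: tdeg1.
elim: k => [|k IH] i j.
  rewrite expr0 shift_coef1; case: i j => [|i] [|j]; rewrite ?eqxx // => _.
  by rewrite !mulr0 addr0.
rewrite exprS shift_coefM => nz.
have [b [a ab]] : exists (b : 'I_j.+1) (a : 'I_i.+1),
    shift_coef xi f a b * shift_coef xi (f ^+ k) (i - a) (j - b) != 0.
  apply: contrapT => no; move/eqP: nz; apply.
  rewrite big1 // => b _; rewrite big1 // => a _.
  by apply: contrapT => ab; apply: no; exists b, a; apply/eqP.
move: ab; rewrite mulf_eq0 negb_or => /andP[/fm fab /IH].
have ai : (a <= i)%N by rewrite -ltnS.
have bj : (b <= j)%N by rewrite -ltnS.
by rewrite !natrB // -natr1; lra.
Qed.

(** The upper bound is needed for one series only, the lower bound for all of them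
    and in one degree only: powers of a polynomial of degree e come within e of any
    degree d, and c (d - e) / d tends to c. *)
Theorem mu_hat_eq (R : realType) (t c : R) : 1 <= t -> 0 <= c ->
    (exists xi : nat -> R[i], xi 0%N = 0 /\ growth_le xi t c) ->
    (exists2 d, (0 < d)%N &
       forall xi : nat -> R[i], xi 0%N = 0 -> attains xi t (c * d%:R) d) ->
  mu_hat t = c.
Proof.
move=> t1 c0 [xi' [xi'0 gr]] [e e0 att].
have [xi [xi0 gen ->//]] := mu_hat_generic R.
have t0 : 0 <= t by lra.
have ub d : ubound
    [set r | exists f, [/\ f != 0, tdeg_le d f & r = qm_val xi t f]] (c * d%:R).
  by move=> _ [f [f0 fd ->]]; exact: (mu_le gen xi'0 t1 gr).
have hi d : mu d xi t <= c * d%:R.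
  apply: ge_sup (ub d).
  exists (qm_val xi t 1), 1; split; [exact: oner_neq0|exact: tdeg1|by []].
have lo d : c * (d%:R - e%:R) <= mu d xi t.
  have [f [f0 fd fm]] := attainsX (d %/ e) (att xi xi0).
  apply: (@le_trans _ _ (qm_val xi t f)).
    apply: qm_val_ge => // i j /fm; apply: le_trans.
    rewrite -mulrA ler_wpM2l // lerBlDr -natrM -natrD ler_nat.
    by rewrite [X in (X <= _)%N](divn_eq d e) mulnC leq_add2l ltnW // ltn_pmod.
  apply: ub_le_sup; first by exists (c * d%:R).
  exists f; split=> // i j /fd; have := leq_trunc_div d e; lia.
apply: cvg_lim => //.
apply: (@squeeze_cvgr _ _ _ _ (fun d => c - c * e%:R * d%:R^-1) (fun=> c)).
- near=> d; have d0 : 0 < d%:R :> R by rewrite ltr0n; near: d; exact: nbhs_infty_gt.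
  rewrite ler_pdivlMr // ler_pdivrMr // hi andbT.
  by rewrite mulrBl mulfVK ?gt_eqF // -mulrBr.
- rewrite -[X in _ --> X]subr0 -[X in _ - X](mulr0 (c * e%:R)).
  apply: cvgB; first exact: cvg_cst.
  apply: cvgM; first exact: cvg_cst.
  apply/gtr0_cvgV0; last exact: cvgr_idn.
  by near=> d; rewrite ltr0n; near: d; exact: nbhs_infty_gt.
- exact: cvg_cst.
Unshelve. all: by end_near.
Qed.

End Reduction.

(** * Curves forced by counting conditions *)

Lemma attains_few (R : realType) (xi : nat -> R[i]) (t m : R) d S :
    (2 * size S < d.+1 * d.+2)%N ->
    (forall i j, (i, j) \notin S -> m <= i%:R + t * j%:R) ->
  attains xi t m d.
Proof.
move=> Sd Sm; have [f [f0 fd fS]] := vanishing_few xi Sd.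
exists f; split=> // i j fij; apply: Sm; apply: contraNN fij => ijS.
by rewrite (fS (i, j)).
Qed.

Section Triangle.
Variables p q : nat.
Hypotheses (p0 : (0 < p)%N) (q0 : (0 < q)%N).

Definition triangle :=
  [set x : 'I_q.+1 * 'I_p.+1 | (p * x.1 + q * x.2 < p * q)%N].

Definition triangle_seq : seq (nat * nat) :=
  [seq (val x.1, val x.2) | x <- enum triangle].

Lemma mem_triangle_seq i j : ((i, j) \in triangle_seq) = (p * i + q * j < p * q)%N.
Proof.
apply/mapP/idP => [[x]|ij]; first by rewrite mem_enum inE => xT [-> ->].
have iq : (i < q.+1)%N by nia.
have jp : (j < p.+1)%N by nia.
by exists (Ordinal iq, Ordinal jp); rewrite ?mem_enum ?inE.
Qed.

(** The half-turn (i, j) |-> (q - i, p - j) of the rectangle [0, q] x [0, p] maps the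
    points below the diagonal injectively to points above it, and the two ends of
    the diagonal belong to neither side. *)
Lemma size_triangle_seq : (2 * size triangle_seq + 2 <= p.+1 * q.+1)%N.
Proof.
rewrite size_map -cardE.
pose T' := [set x : 'I_q.+1 * 'I_p.+1 | (p * q < p * x.1 + q * x.2)%N].
pose rv (x : 'I_q.+1 * 'I_p.+1) := (rev_ord x.1, rev_ord x.2).
have rv_inj : injective rv.
  move=> [a b] [c d] /= e; congr pair; apply: rev_ord_inj.
    by have := congr1 fst e.
  by have := congr1 snd e.
have le1 : (#|triangle| <= #|T'|)%N.
  rewrite -(card_imset _ rv_inj); apply: subset_leq_card.
  apply/fintype.subsetP => _ /imsetP[x xT ->].
  move: xT; rewrite !inE /= !subSS.
  by have := ltn_ord x.1; have := ltn_ord x.2; rewrite !mulnBr; nia.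
pose E : {set 'I_q.+1 * 'I_p.+1} := [set (ord0, ord_max); (ord_max, ord0)].
have cE : #|E| = 2%N.
  rewrite cards2 (_ : (_ != _) = true) //; apply/eqP => -[].
  by move=> e _; have := q0; rewrite -e.
have dT : [disjoint triangle & T'].
  by rewrite -setI_eq0; apply/eqP/setP => x; rewrite !inE; lia.
have dE : [disjoint triangle :|: T' & E].
  rewrite -setI_eq0; apply/eqP/setP => x; rewrite !inE.
  by apply/negP => /andP[+ /orP[] /eqP xE]; rewrite xE /=; nia.
have := max_card (mem (triangle :|: T' :|: E)).
rewrite cardsU (disjoint_setI0 dE) cards0 cardsU (disjoint_setI0 dT) cards0 cE.
rewrite card_prod !card_ord (mulnC q.+1) !subn0; apply: leq_trans.
by rewrite mul2n -addnn leq_add2r leq_add2l; exact: le1.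
Qed.
End Triangle.

(** The hypotheses on p and q make the number of conditions, at most
    (p q + p + q - 1) / 2 = (d^2 + 3 d) / 2, one less than the number of
    coefficients.  Outside the triangle i / q + j / p >= 1, so the weight of (i, j)
    is at least min(q, p t). *)
Lemma attains_triangle (R : realType) (xi : nat -> R[i]) (t m : R) p q d :
    (0 < p)%N -> (0 < q)%N -> (p * q = d * d + 1)%N -> (p + q = 3 * d)%N ->
    0 <= m -> m <= q%:R -> m <= p%:R * t ->
  attains xi t m d.
Proof.
move=> p0 q0 pq pDq m0 mq mp; apply: (@attains_few _ _ _ _ _ (triangle_seq p q)).
  have E : (p.+1 * q.+1 = d.+1 * d.+2)%N by rewrite mulSn mulnS pq; lia.
  by rewrite -E; apply: leq_trans (size_triangle_seq p0 q0); rewrite addn2.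
move=> i j; rewrite mem_triangle_seq // -leqNgt => ij.
have {}ij : p%:R * q%:R <= p%:R * i%:R + q%:R * j%:R :> R.
  by rewrite -!natrM -natrD ler_nat.
have pq0 : 0 < p%:R * q%:R :> R by rewrite mulr_gt0 ?ltr0n.
rewrite -(ler_pM2l pq0); apply: le_trans (_ : m * (p%:R * i%:R + q%:R * j%:R) <= _).
  by rewrite mulrC ler_wpM2l.
rewrite !mulrDr lerD //.
  rewrite (_ : p%:R * q%:R * i%:R = q%:R * (p%:R * i%:R)); last by ring.
  by rewrite ler_wpM2r // mulr_ge0.
rewrite (_ : p%:R * q%:R * (t * j%:R) = p%:R * t * (q%:R * j%:R)); last by ring.
by rewrite ler_wpM2r // mulr_ge0.
Qed.

(** Nine conditions on the ten coefficients of a cubic: no monomial y and no x^i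
    with i < 8, which leaves weights at least min(8, 1 + t). *)
Lemma attains_cubic (R : realType) (xi : nat -> R[i]) (t m : R) :
    1 <= t -> m <= 8 -> m <= 1 + t ->
  attains xi t m 3.
Proof.
move=> t1 m8 mt.
apply: (@attains_few _ _ _ _ _ ((0, 1) :: [seq (i, 0) | i <- iota 0 8])%N) => //.
move=> i [|[|j]].
- have [i8|i8 _] := ltnP i 8; last first.
    have : 8%:R <= i%:R :> R by rewrite ler_nat.
    by rewrite mulr0 addr0; lra.
  by rewrite inE negb_or => /andP[_ /mapP[]]; exists i => //; rewrite mem_iota.
- case: i => [|i] // _; have : 1%:R <= i.+1%:R :> R by rewrite ler_nat.
  by rewrite mulr1; lra.
- move=> _; have : 2%:R <= j.+2%:R :> R by rewrite ler_nat.
  have : 0 <= i%:R :> R by [].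
  by nra.
Qed.

(** * Exchange polynomials with Fibonacci exponents *)

Lemma fibSS n : fib n.+2 = (fib n.+1 + fib n)%N.
Proof. by []. Qed.

(** F_(2 n - 1), including F_(-1) = 1. *)
Definition ofib (n : nat) : nat := if n is m.+1 then fib m.*2.+1 else 1%N.

Lemma ofib_rec n : (ofib n + ofib n.+2 = 3 * ofib n.+1)%N.
Proof.
case: n => [//|n]; rewrite /ofib !doubleS.
rewrite (fibSS n.*2.+2.+1) (fibSS n.*2.+2) (fibSS n.*2.+1); lia.
Qed.

Lemma fib_gt0 n : (0 < fib n.+1)%N.
Proof. by elim: n => // n IH; rewrite fibSS; lia. Qed.

Lemma fib_double_rec n : (fib n.+2.*2 + fib n.*2 = 3 * fib n.+1.*2)%N.
Proof. rewrite !doubleS (fibSS n.*2.+2) (fibSS n.*2.+1) (fibSS n.*2); lia. Qed.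

(** The Laurent phenomenon in rank two: modulo p2, the first relation says
    p1^3 = - X^a and the second p1 p3 = X^b, so that p1^3 (p3^3 + X^c) is
    X^(3 b) - X^(a + c) = 0, and p1 is invertible. *)
Lemma exchange_dvd (F : fieldType) (p0 p1 p2 p3 : {poly F}) a b c :
    p0 * p2 = p1 ^+ 3 + 'X^a -> p1 * p3 = p2 ^+ 3 + 'X^b ->
    coprimep p1 p2 -> (a + c = 3 * b)%N ->
  p2 %| p3 ^+ 3 + 'X^c.
Proof.
move=> e1 e2 cop abc.
have cop' : coprimep p2 (p1 ^+ 3) by rewrite coprimep_sym coprimep_expl.
rewrite -(Gauss_dvdpr _ cop').
have p1E : p1 ^+ 3 = p0 * p2 - 'X^a by rewrite e1 addrK.
rewrite mulrDr -exprMn e2 p1E mulrBl -exprD abc mulnC exprM.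
set Y := 'X^b; rewrite (_ : _ ^+ 3 + (_ - _) =
  p2 * (p2 ^+ 8 + 3 * p2 ^+ 5 * Y + 3 * p2 ^+ 2 * Y ^+ 2 + p0 * 'X^c)).
  exact: dvdp_mulIl.
by ring.
Qed.

(** The sequence starts from constants and continues while the exponents satisfy
    the Fibonacci relation.  [exch n] is A_(2 (M - n) + 1) in the notation of the
    introduction when e k = F_(2 (M - k) - 1): it goes down from A_(2 M + 1) and
    A_(2 M - 1), and reaches y, x and A_(-3) at M, M + 1 and M + 2. *)
Section Exchange.
Variables (F : fieldType) (e : nat -> nat) (c0 c1 : F).

Fixpoint exch_pair n : {poly F} * {poly F} :=
  if n is m.+1 then
    let u := exch_pair m in (u.2, (u.2 ^+ 3 + 'X^(e m)) %/ u.1)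
  else (c0%:P, c1%:P).
Definition exch n := (exch_pair n).1.

Lemma exchSS n : exch n.+2 = (exch n.+1 ^+ 3 + 'X^(e n)) %/ exch n.
Proof. by []. Qed.

Variable M : nat.
Hypotheses (c0_neq0 : c0 != 0) (c1_neq0 : c1 != 0).
Hypothesis e_gt0 : forall n, (n <= M)%N -> (0 < e n)%N.
Hypothesis e_rec : forall n, (n.+2 <= M)%N -> (e n + e n.+2 = 3 * e n.+1)%N.

(** Divisibility at step n uses the two preceding relations ([exchange_dvd]);
    coprimality of consecutive terms follows from the relation itself, as a common
    factor would divide a power of X while no term vanishes at 0. *)
Lemma exchP n : (n <= M)%N ->
  [/\ exch n * exch n.+2 = exch n.+1 ^+ 3 + 'X^(e n),
      coprimep (exch n.+1) (exch n), (exch n).[0] != 0 & (exch n.+1).[0] != 0].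
Proof.
have step m : (m <= M)%N -> exch m %| exch m.+1 ^+ 3 + 'X^(e m) ->
    exch m * exch m.+2 = exch m.+1 ^+ 3 + 'X^(e m).
  by move=> mM dv; rewrite exchSS mulrC divpK.
elim/ltn_ind: n => -[|n] IH nM.
  split; [|by rewrite /exch /= -alg_polyC coprimepZl ?coprime1p
          |by rewrite hornerC | by rewrite hornerC].
  by apply: step => //; rewrite dvdUp // /exch /= polyC_eqp1 c0_neq0.
have [r1 cop1 z1 z2] := IH n (ltnSn n) (ltnW nM).
have cop2 : coprimep (exch n.+2) (exch n.+1).
  have : coprimep (exch n.+1) (exch n * exch n.+2).
    rewrite r1 exprSr coprimep_addl_mul coprimep_expr // coprimepX.
    by rewrite /root.
  by rewrite coprimepMr coprimep_sym => /andP[_]; rewrite coprimep_sym.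
have z3 : (exch n.+2).[0] != 0.
  have := congr1 (horner^~ 0) r1.
  rewrite /= hornerM hornerD horner_exp hornerXn expr0n.
  rewrite gtn_eqF ?e_gt0 ?(ltnW nM) // addr0 => E.
  by apply: contraNneq (expf_neq0 3 z2) => zz; rewrite -E zz mulr0.
split=> //; apply: step => //.
case: n IH nM r1 cop1 z1 z2 cop2 z3 => [|n] IH nM r1 cop1 z1 z2 cop2 z3.
  by rewrite dvdUp // /exch /= polyC_eqp1 c1_neq0.
have [r0 cop0 _ _] := IH n (ltnW (ltnSn _)) (ltnW (ltnW nM)).
apply: (exchange_dvd r0 r1); first by rewrite coprimep_sym.
exact: e_rec.
Qed.

Lemma exch_neq0 n : (n <= M.+2)%N -> exch n != 0.
Proof.
case: n => [|n]; first by move=> _; rewrite polyC_eq0.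
rewrite ltnS leq_eqVlt => /predU1P[->|].
  have [r _ _ z2] := exchP (leqnn M).
  apply: contraTneq (e_gt0 (leqnn M)) => z; have := congr1 (horner^~ 0) r.
  rewrite z mulr0 /= horner0 hornerD horner_exp hornerXn expr0n => /esym/eqP.
  by case: (e M) => //=; rewrite addr0 expf_eq0 /= (negPf z2).
by rewrite ltnS => /exchP[_ _ _]; apply: contraNneq => ->; rewrite horner0.
Qed.

(** Values at a point determine the sequence: if the constants were read off from
    a sequence of numbers satisfying the recursion, evaluation returns those
    numbers. *)
Lemma exch_eval (N0 : F) (a : nat -> F) : c0 = a M.+2 -> c1 = a M.+1 ->
    (forall k, (k <= M.+2)%N -> a k != 0) ->
    (forall k, (k <= M)%N -> a k * a k.+2 = a k.+1 ^+ 3 + N0 ^+ e (M - k)) ->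
  forall n, (n <= M.+2)%N -> (exch n).[N0] = a (M.+2 - n)%N.
Proof.
move=> c0E c1E a0 arec n nM.
suff H m : (m <= M.+1)%N ->
    (exch m).[N0] = a (M.+2 - m)%N /\ (exch m.+1).[N0] = a (M.+1 - m)%N.
  case: n nM => [|n nM]; last by have [_ ->] := H n nM.
  by move=> _; have [] := H 0%N isT.
elim: m => [_|m IH mM]; first by rewrite /exch /= !hornerC c0E c1E.
have [IH1 IH2] := IH (ltnW mM); split; first by rewrite IH2.
have [r _ _ _] := exchP mM; have := congr1 (horner^~ N0) r.
rewrite /= hornerM hornerD horner_exp hornerXn IH1 IH2.
have -> : (M.+2 - m = (M - m).+2)%N by lia.
have -> : (M.+1 - m = (M - m).+1)%N by lia.
have := arec _ (leq_subr m M); rewrite subKn // => <- /eqP.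
rewrite mulrC !subSS (inj_eq (mulIf _)) => [/eqP //|].
by apply: a0; lia.
Qed.
End Exchange.

(** From the second term on, the cube dominates the power of X, so the degrees
    follow d_(n+1) = 3 d_n - d_(n-1), the recursion of the even Fibonacci numbers. *)
Lemma exch_size (F : fieldType) (c0 c1 : F) M n :
    c0 != 0 -> c1 != 0 -> (n <= M)%N ->
  let p := exch (fun k => ofib (M - k)) c0 c1 in
  size (p n.+1) = (ofib M * fib n.*2).+1.
Proof.
move=> c00 c10 + p; pose e k := ofib (M - k).
have e_gt0 k : (0 < e k)%N by rewrite /e; case: (M - k)%N => //= m; exact: fib_gt0.
have e_rec k : (k.+2 <= M)%N -> (e k + e k.+2 = 3 * e k.+1)%N.
  move=> kM; rewrite /e addnC; have -> : (M - k = (M - k.+2).+2)%N by lia.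
  have -> : (M - k.+1 = (M - k.+2).+1)%N by lia.
  exact: ofib_rec.
have e_le k : (e k <= ofib M)%N.
  rewrite /e; elim: k => [|k IH]; first by rewrite subn0.
  apply: leq_trans IH; rewrite subnS; case: (M - k)%N => [//|[//|m]].
  by rewrite [m.+2.-1]/= /ofib doubleS (fibSS m.*2.+1) (fibSS m.*2); lia.
have P k := @exchP F e c0 c1 M c00 c10 (fun k _ => e_gt0 k) e_rec k.
have nz k := @exch_neq0 F e c0 c1 M c00 c10 (fun k _ => e_gt0 k) e_rec k.
elim/ltn_ind: n => -[|[|n]] IH nM.
- by rewrite muln0 /p /exch /= size_polyC c10.
- have [r _ _ _] := P 0%N isT.
  rewrite muln1 /p exchSS /= size_divp ?polyC_eq0 // size_polyC c00 subn0.
  rewrite addrC size_polyDl size_polyXn ?subn0 //.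
  rewrite /exch /= -rmorphXn /= size_polyC expf_neq0 // ltnS.
  by have := e_gt0 0%N; rewrite /e subn0.
have s1 := IH n.+1 (ltnSn _) (ltnW nM).
have s0 := IH n (ltnW (ltnSn _)) (ltnW (ltnW nM)).
have [r _ _ _] := P n.+1 (ltnW nM).
have := congr1 (fun q : {poly F} => size q) r.
rewrite size_mul; [|by apply: nz; lia|by apply: nz; lia].
have pE : p = exch e c0 c1 by [].
rewrite -!pE in r nz *; rewrite s0.
have sz3 : size (p n.+2 ^+ 3) = (3 * (ofib M * fib n.+1.*2)).+1.
  have s3 : size (p n.+2 ^+ 3) != 0%N.
    by rewrite size_poly_eq0 expf_neq0 // nz //; lia.
  have := size_exp (p n.+2) 3; rewrite s1 succnK mulnC => <-.
  by rewrite prednK // lt0n.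
have F2 : (0 < fib n.+1.*2)%N by rewrite doubleS; exact: fib_gt0.
have o0 : (0 < ofib M)%N by have := e_gt0 0%N; rewrite /e subn0.
rewrite size_polyDl ?sz3; last first.
  rewrite size_polyXn !ltnS; apply: leq_ltn_trans (e_le _) _.
  by move: (ofib M) o0 (fib n.+1.*2) F2 => o o0 f f0; nia.
have : (ofib M * fib n.+2.*2 + ofib M * fib n.*2 = 3 * (ofib M * fib n.+1.*2))%N.
  by rewrite -mulnDr fib_double_rec; ring.
by case: (size (p n.+3)) => [|s] /=; lia.
Qed.

(** * Evaluation and orders of vanishing *)

Section Eval.
Variables (F : fieldType) (L : fieldType) (iota : {rmorphism F -> L}).

Definition ev1 (X : L) : {poly F} -> L := horner_eval X \o map_poly iota.
HB.instance Definition _ X :=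
  GRing.RMorphism.copy (ev1 X) (horner_eval X \o map_poly iota).

Definition ev (X Y : L) : {poly {poly F}} -> L :=
  horner_eval Y \o map_poly (ev1 X).
HB.instance Definition _ X Y :=
  GRing.RMorphism.copy (ev X Y) (horner_eval Y \o map_poly (ev1 X)).

Lemma ev1X X : ev1 X 'X = X.
Proof. by rewrite /ev1 /= map_polyX /horner_eval hornerX. Qed.

Lemma ev1_0 X : ev1 X 0 = 0. Proof. exact: raddf0. Qed.
Lemma ev1_1 X : ev1 X 1 = 1. Proof. exact: rmorph1. Qed.
Lemma ev1D X : {morph ev1 X : p q / p + q}. Proof. exact: rmorphD. Qed.
Lemma ev1M X : {morph ev1 X : p q / p * q}. Proof. exact: rmorphM. Qed.
Lemma ev1Xn X n : {morph ev1 X : p / p ^+ n}. Proof. exact: rmorphXn. Qed.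

Lemma evC X Y p : ev X Y p%:P = ev1 X p.
Proof. by rewrite /ev /= map_polyC /= /horner_eval hornerC. Qed.

Lemma evX X Y : ev X Y 'X = Y.
Proof. by rewrite /ev /= map_polyX /horner_eval hornerX. Qed.

Lemma evB X Y : {morph ev X Y : f g / f - g}. Proof. exact: rmorphB. Qed.
Lemma evD X Y : {morph ev X Y : f g / f + g}. Proof. exact: rmorphD. Qed.
Lemma evM X Y : {morph ev X Y : f g / f * g}. Proof. exact: rmorphM. Qed.
Lemma evXn X Y n : {morph ev X Y : f / f ^+ n}. Proof. exact: rmorphXn. Qed.

Lemma ev_shift X Y f q : ev X Y (f \Po ('X + q%:P)) = ev X (Y + ev1 X q) f.
Proof.
rewrite {1}/ev /= (map_comp_poly (ev1 X)) /horner_eval horner_comp rmorphD /=.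
by rewrite map_polyX map_polyC /= !hornerE.
Qed.

Lemma ev_sum X Y (f : {poly {poly F}}) : ev X Y f =
  \sum_(j < size f) \sum_(i < size f`_j) iota f`_j`_i * X ^+ i * Y ^+ j.
Proof.
rewrite /ev /= /horner_eval (horner_coef_wide _ (size_poly _ _)).
apply: eq_bigr => j _; rewrite coef_map /= /ev1 /= /horner_eval.
rewrite (horner_coef_wide _ (size_poly _ _)) mulr_suml.
by apply: eq_bigr => i _; rewrite coef_map.
Qed.

(** What is used of the order of vanishing at a point of a curve; [O k a] reads: a
    has order at least k. *)
Record filtration (O : nat -> L -> Prop) : Prop := Filtration {
  filt0 : forall k, O k 0;
  filtD : forall k a b, O k a -> O k b -> O k (a + b);
  filtM : forall k l a b, O k a -> O l b -> O (k + l)%N (a * b);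
  filtC : forall c, O 0%N (iota c);
  filtW : forall k l a, (k <= l)%N -> O l a -> O k a }.

Variable O : nat -> L -> Prop.
Hypothesis OP : filtration O.

Lemma filtX k a n : O k a -> O (n * k)%N (a ^+ n).
Proof.
move=> Oa; elim: n => [|n IH].
  by rewrite expr0 -[1](rmorph1 iota); exact: (filtC OP).
by rewrite exprS mulSn; exact: (filtM OP).
Qed.

Lemma filt_sum k (I : Type) (r : seq I) (f : I -> L) :
  (forall i, O k (f i)) -> O k (\sum_(i <- r) f i).
Proof.
move=> Of; elim: r => [|i r IH]; first by rewrite big_nil; exact: (filt0 OP).
by rewrite big_cons; exact: (filtD OP).
Qed.

Lemma filt_ev K a b X Y (f : {poly {poly F}}) : O a X -> O b Y ->
    (forall i j, f`_j`_i != 0 -> (K <= a * i + b * j)%N) ->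
  O K (ev X Y f).
Proof.
move=> OX OY fK; rewrite ev_sum; apply: filt_sum => j; apply: filt_sum => i.
have [->|/fK ij] := eqVneq (f`_j`_i) 0.
  by rewrite raddf0 !mul0r; exact: (filt0 OP).
apply: (filtW OP ij); apply: (filtM OP); last by rewrite mulnC; exact: filtX.
rewrite -[(a * i)%N]add0n mulnC; apply: (filtM OP); first exact: (filtC OP).
exact: filtX.
Qed.

(** If x has order a and y - q(x) has order b at a point of a curve, f restricted to
    the curve has at least the least weight a i + b j of its monomials. *)
Lemma filt_shift_coef K a b X Y q f : O a X -> O b (Y - ev1 X q) ->
    (forall i j, shift_coef (fun k => q`_k) f i j != 0 -> (K <= a * i + b * j)%N) ->
  O K (ev X Y f).
Proof.
move=> OX OY fK; rewrite -[Y](subrK (ev1 X q)) -ev_shift.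
apply: filt_ev OX OY _ => i j; rewrite -shift_coef_poly; exact: fK.
Qed.

End Eval.

(** The homogenization of f in degree d at x, y, z; the truncated exponent is only
    met with [i + j <= d] when f has degree at most d. *)
Definition homog (A : comNzRingType) (d : nat) (f : {poly {poly A}})
    (x y z : {poly A}) : {poly A} :=
  \sum_(j < d.+1) \sum_(i < d.+1)
    f`_j`_i *: (x ^+ i * y ^+ j * z ^+ (d - (i + j))).

Lemma ev_homog (F L : fieldType) (iota : {rmorphism F -> L})
    (psi : {rmorphism {poly F} -> L}) d f x y z :
    (forall c, psi c%:P = iota c) -> tdeg d f -> psi z != 0 ->
  ev iota (psi x / psi z) (psi y / psi z) f = psi (homog d f x y z) / psi z ^+ d.
Proof.
move=> psiC fd z0; rewrite /ev /= /horner_eval.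
have sf : (size (map_poly (ev1 iota (psi x / psi z)) f) <= d.+1)%N.
  apply/leq_sizeP => j dj; rewrite coef_map /=.
  rewrite (_ : f`_j = 0) ?raddf0 //; apply/polyP => i; rewrite coef0.
  by apply/eqP; apply: contraTT dj => /fd; lia.
rewrite (horner_coef_wide _ sf) /homog raddf_sum mulr_suml.
apply: eq_bigr => j _; rewrite coef_map /= /ev1 /= /horner_eval.
have sfj : (size (map_poly iota f`_j) <= d.+1)%N.
  apply/leq_sizeP => i di; rewrite coef_map /=.
  rewrite (_ : f`_j`_i = 0) ?raddf0 //.
  by apply/eqP; apply: contraTT di => /fd; lia.
rewrite (horner_coef_wide _ sfj) raddf_sum !mulr_suml.
apply: eq_bigr => i _; rewrite coef_map /= -mul_polyC rmorphM psiC.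
have [->|/fd ijd] := eqVneq (f`_j`_i) 0; first by rewrite raddf0 !mul0r.
rewrite !rmorphM !rmorphXn.
have -> : psi z ^+ d = psi z ^+ (d - (i + j)) * psi z ^+ (i + j).
  by rewrite -exprD subnK.
rewrite !exprMn !exprVn exprD; field.
by rewrite !expf_neq0.
Qed.

Section Orders.
Variable F : fieldType.
Local Notation L := {fraction {poly F}}.
Local Notation "p %:F" := (tofrac p).

(** Order of vanishing at infinity on the projective line.  Negative orders are
    needed for the inverse of a function that vanishes there. *)
Definition ord_inf (k : int) (r : L) : Prop :=
  exists n d : {poly F}, [/\ d != 0, r = n%:F / d%:F & (size n)%:Z + k <= (size d)%:Z].

Definition const : F -> L := @tofrac _ \o polyC.
HB.instance Definition _ := GRing.RMorphism.copy const (@tofrac _ \o polyC).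

Lemma size_mulz (p q : {poly F}) : p != 0 -> q != 0 ->
  (size (p * q))%:Z = (size p)%:Z + (size q)%:Z - 1.
Proof.
move=> p0 q0; rewrite size_mul //; move: p0 q0.
rewrite -!size_poly_gt0; case: (size p) (size q) => [|a] [|b] // _ _.
by rewrite addSn addnS /=; lia.
Qed.

Lemma size_mulz_le (p q : {poly F}) k : q != 0 ->
  (size p)%:Z + k <= (size q)%:Z ->
  forall r : {poly F}, r != 0 -> (size (p * r))%:Z + k <= (size (q * r))%:Z.
Proof.
move=> q0 pq r r0; have := size_mulz q0 r0.
have r1 : (0 < size r)%N by rewrite lt0n size_poly_eq0.
have [->|p0] := eqVneq p 0; last by have := size_mulz p0 r0; lia.
have q1 : (0 < size q)%N by rewrite lt0n size_poly_eq0.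
by rewrite mul0r size_poly0; move: pq; rewrite ?size_poly0; lia.
Qed.

Lemma ord_inf0 k : ord_inf k 0.
Proof.
exists 0, 'X^`|k|%N; split; first by rewrite -size_poly_eq0 size_polyXn.
  by rewrite tofrac0 mul0r.
by rewrite size_poly0 size_polyXn; lia.
Qed.

Lemma ord_infD k r s : ord_inf k r -> ord_inf k s -> ord_inf k (r + s).
Proof.
move=> [n1 [d1 [d10 -> s1]]] [n2 [d2 [d20 -> s2]]].
exists (n1 * d2 + n2 * d1), (d1 * d2); split; first by rewrite mulf_neq0.
  by rewrite addf_div ?tofrac_eq0 // -!tofracM -tofracD.
have := size_mulz_le d10 s1 d20; have := size_mulz_le d20 s2 d10.
rewrite [d2 * d1]mulrC; have := size_polyD (n1 * d2) (n2 * d1).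
move: (size _) (size _) (size _) (size _) => a b c e; lia.
Qed.

Lemma ord_infM k l r s : ord_inf k r -> ord_inf l s -> ord_inf (k + l) (r * s).
Proof.
move=> [n1 [d1 [d10 -> s1]]] [n2 [d2 [d20 -> s2]]].
have [->|n10] := eqVneq n1 0; first by rewrite tofrac0 !mul0r; exact: ord_inf0.
have [->|n20] := eqVneq n2 0.
  by rewrite tofrac0 mul0r mulr0; exact: ord_inf0.
exists (n1 * n2), (d1 * d2); split; first by rewrite mulf_neq0.
  by rewrite mulf_div -!tofracM.
rewrite size_mulz // size_mulz //.
move: (size _) (size _) (size _) (size _) s1 s2 => a b c e; lia.
Qed.

Lemma ord_inf_frac k (g h : {poly F}) : h != 0 ->
  (size g)%:Z + k <= (size h)%:Z -> ord_inf k (g%:F / h%:F).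
Proof. by move=> h0 sgh; exists g, h. Qed.

Lemma ord_infW k l r : k <= l -> ord_inf l r -> ord_inf k r.
Proof.
move=> kl [n [d [d0 -> sd]]]; apply: ord_inf_frac => //.
by move: (size _) (size _) sd => a b; lia.
Qed.

Lemma ord_inf_const c : ord_inf 0 (const c).
Proof.
exists c%:P, 1; split; [exact: oner_neq0|by rewrite tofrac1 divr1|].
by rewrite size_polyC size_poly1; case: (c != 0).
Qed.

Lemma ord_inf_le k (g h : {poly F}) : g != 0 -> h != 0 ->
  ord_inf k (g%:F / h%:F) -> (size g)%:Z + k <= (size h)%:Z.
Proof.
move=> g0 h0 [n [d [d0 E sd]]].
have {}E : g * d = n * h.
  apply/eqP; rewrite -tofrac_eq !tofracM -(eqr_div _ _ _ _) ?tofrac_eq0 //.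
  exact/eqP.
have n0 : n != 0.
  by apply: contraNneq (mulf_neq0 g0 d0) => z; rewrite E z mul0r.
have := size_mulz g0 d0; have := size_mulz n0 h0; rewrite E.
by move: (size _) (size _) (size _) (size _) (size _) sd => a b c e f; lia.
Qed.

Lemma filtration_inf : filtration const (fun k => ord_inf k%:Z).
Proof.
split=> [k|k a b|k l a b|c|k l a kl].
- exact: ord_inf0.
- exact: ord_infD.
- by rewrite PoszD; exact: ord_infM.
- exact: ord_inf_const.
- by apply: ord_infW.
Qed.

(** Order of vanishing at 0 on the projective line. *)
Definition ord_zero (k : nat) (r : L) : Prop :=
  exists n d : {poly F}, d.[0] != 0 /\ r = ('X^k * n)%:F / d%:F.

Lemma horner0_neq0 (d : {poly F}) : d.[0] != 0 -> d != 0.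
Proof. by apply: contraNneq => ->; rewrite horner0. Qed.

Lemma filtration_zero : filtration const ord_zero.
Proof.
split=> [k|k a b|k l a b|c|k l a kl].
- by exists 0, 1; rewrite hornerC oner_eq0 mulr0 tofrac0 mul0r.
- move=> [n1 [d1 [d10 ->]]] [n2 [d2 [d20 ->]]].
  exists (n1 * d2 + n2 * d1), (d1 * d2); rewrite hornerM mulf_neq0 //; split=> //.
  rewrite addf_div ?tofrac_eq0 ?horner0_neq0 // -!tofracM -tofracD.
  by congr (_%:F / _); ring.
- move=> [n1 [d1 [d10 ->]]] [n2 [d2 [d20 ->]]].
  exists (n1 * n2), (d1 * d2); rewrite hornerM mulf_neq0 //; split=> //.
  by rewrite mulf_div -!tofracM; congr (_%:F / _); rewrite exprD; ring.
- by exists c%:P, 1; rewrite hornerC oner_eq0 expr0 mul1r tofrac1 divr1.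
- move=> [n [d [d0 ->]]]; exists ('X^(l - k) * n), d; split=> //.
  by rewrite mulrA -exprD subnKC.
Qed.

Lemma ord_zero_dvd k (g h : {poly F}) : h.[0] != 0 ->
  ord_zero k (g%:F / h%:F) -> 'X^k %| g.
Proof.
move=> h0 [n [d [d0 E]]].
have {}E : g * d = 'X^k * n * h.
  apply/eqP; rewrite -tofrac_eq !(tofracM g, tofracM _ h).
  by rewrite -(eqr_div _ _ _ _) ?tofrac_eq0 ?horner0_neq0 //; exact/eqP.
have cop : coprimep 'X^k d.
  by rewrite coprimep_expl // coprimep_sym coprimepX.
by rewrite -(Gauss_dvdpl _ cop) E -mulrA dvdp_mulIl.
Qed.

End Orders.

(** * A pencil of rational cuspidal curves *)

Lemma ofib_gt0 n : (0 < ofib n)%N.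
Proof. by case: n => // n; exact: fib_gt0. Qed.

Lemma fib_even_odd n : (fib n.*2 + ofib n = ofib n.+1)%N.
Proof. by case: n => // n; rewrite /ofib doubleS (fibSS n.*2.+1). Qed.

Lemma fib_odd_even n : (fib n.*2 + ofib n.+1 = fib n.+1.*2)%N.
Proof. by rewrite /ofib doubleS (fibSS n.*2) addnC. Qed.

Lemma markov n :
  (ofib n * ofib n + ofib n.+1 * ofib n.+1 + 1 = 3 * ofib n * ofib n.+1)%N.
Proof.
elim: n => // n; have := ofib_rec n.
move: (ofib n) (ofib n.+1) (ofib n.+2) => a b c; nia.
Qed.

(** The sequence A_(2 n - 3) at a point where x, y and N take the values x0, y0 and
    N0.  For positive values every term is positive, so the divisions are
    legitimate. *)
Section Forward.
Variables (F : numFieldType) (x0 y0 N0 : F).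

Fixpoint fwd_pair n : F * F :=
  if n is m.+1 then
    let u := fwd_pair m in (u.2, (u.2 ^+ 3 + N0 ^+ ofib m) / u.1)
  else ((x0 ^+ 3 + N0) / y0, x0).
Definition fwd n := (fwd_pair n).1.

Hypotheses (x0_gt0 : 0 < x0) (y0_gt0 : 0 < y0) (N0_gt0 : 0 < N0).

Lemma fwd_gt0 n : 0 < fwd n.
Proof.
suff H m : 0 < fwd m /\ 0 < fwd m.+1 by have [] := H n.
elim: m => [|m [IH1 IH2]].
  by split=> //; rewrite /fwd /= divr_gt0 // addr_gt0 // exprn_gt0.
split=> //; rewrite [fwd m.+2]/(_ / _) divr_gt0 //.
by rewrite addr_gt0 // exprn_gt0.
Qed.

Lemma fwd_rec n : fwd n * fwd n.+2 = fwd n.+1 ^+ 3 + N0 ^+ ofib n.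
Proof.
by rewrite [fwd n.+2]/(_ / _) mulrC divfK // gt_eqF // fwd_gt0.
Qed.

Lemma fwd2 : fwd 2 = y0.
Proof.
have := fwd_rec 0; have := fwd_gt0 0; rewrite /fwd /= expr1 => a0.
rewrite mulrC divfK ?gt_eqF // => _.
by rewrite invf_div mulrCA mulfV ?mulr1 // gt_eqF // addr_gt0 // exprn_gt0.
Qed.

(** The member of the pencil through a given point, parametrized by N: its
    constants are the values of A_(2 M + 1) and A_(2 M - 1) at the point.  The
    coordinate z is recovered from x y z = N + x^3 + y^3, whose right-hand side is
    divisible by the coprime polynomials x and y by the last two exchange
    relations. *)
Lemma pencil_member M : (0 < M)%N -> x0 * y0 = N0 + x0 ^+ 3 + y0 ^+ 3 ->
  exists x y z : {poly F},
  [/\ [/\ x.[N0] = x0, y.[N0] = y0 & z.[N0] = 1],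
      x * y * z = 'X + x ^+ 3 + y ^+ 3,
      size x = (ofib M * fib M.*2).+1 & size y = (ofib M * fib M.-1.*2).+1].
Proof.
move=> M0 xyN; pose e k := ofib (M - k).
pose p := exch e (fwd M.+2) (fwd M.+1).
have c0 : fwd M.+2 != 0 by rewrite gt_eqF // fwd_gt0.
have c1 : fwd M.+1 != 0 by rewrite gt_eqF // fwd_gt0.
have e_gt0 k : (k <= M)%N -> (0 < e k)%N by rewrite ofib_gt0.
have e_rec k : (k.+2 <= M)%N -> (e k + e k.+2 = 3 * e k.+1)%N.
  move=> kM; rewrite /e addnC; have -> : (M - k = (M - k.+2).+2)%N by lia.
  have -> : (M - k.+1 = (M - k.+2).+1)%N by lia.
  exact: ofib_rec.
have P k := exchP c0 c1 e_gt0 e_rec (n := k).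
have nz k := exch_neq0 c0 c1 e_gt0 e_rec (n := k).
have [rM _ _ _] := P M (leqnn M).
have [rM' cop _ _] := P M.-1 (leq_pred M).
move: rM'; rewrite (prednK M0) -/p => rM'; move: cop; rewrite prednK // => cop'.
have xval : (p M.+1).[N0] = x0.
  rewrite (exch_eval c0 c1 e_gt0 e_rec (a := fwd)) //.
  - by rewrite (_ : _ - _ = 1)%N //; lia.
  - by move=> k _; rewrite gt_eqF // fwd_gt0.
  - by move=> k kM; rewrite fwd_rec /e subKn.
have yval : (p M).[N0] = y0.
  rewrite (exch_eval c0 c1 e_gt0 e_rec (a := fwd)) //.
  - by rewrite (_ : _ - _ = 2)%N ?fwd2 //; lia.
  - by move=> k _; rewrite gt_eqF // fwd_gt0.
  - by move=> k kM; rewrite fwd_rec /e subKn.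
  - lia.
have cop : coprimep (p M.+1) (p M) by have [_] := P M (leqnn M).
have dv : p M.+1 * p M %| 'X + p M.+1 ^+ 3 + p M ^+ 3.
  have eM : e M = 1%N by rewrite /e subnn.
  have eM' : e M.-1 = 1%N by rewrite /e (_ : M - M.-1 = 1)%N //; lia.
  move: rM rM'; rewrite eM eM' -/p !expr1 => rM rM'.
  rewrite Gauss_dvdp //; apply/andP; split.
    rewrite (_ : _ + _ = p M.-1 * p M.+1 + p M.+1 ^+ 2 * p M.+1); last first.
      by rewrite rM'; ring.
    by rewrite -mulrDl dvdp_mulIr.
  rewrite (_ : _ + _ = p M * p M.+2 + p M * p M ^+ 2); last by rewrite rM; ring.
  by rewrite -mulrDr dvdp_mulIl.
exists (p M.+1), (p M), (('X + p M.+1 ^+ 3 + p M ^+ 3) %/ (p M.+1 * p M)).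
have zE := divpK dv; split.
- split=> //; have := congr1 (horner^~ N0) zE.
  rewrite /= !(hornerM, hornerD, hornerX, horner_exp) xval yval xyN => E.
  have xy0 : x0 * y0 != 0 by rewrite gt_eqF // mulr_gt0.
  by apply: (mulIf xy0); rewrite mul1r xyN E.
- by rewrite mulrC.
- exact: exch_size.
- by rewrite -{1}(prednK M0); apply: exch_size => //; lia.
Qed.
End Forward.

(** Polynomial approximations x^2 w of the branch y = x^2 + y^3 / x of the nodal
    cubic x y = x^3 + y^3; the equation for w is w = 1 + x^3 w^3, and the n-th
    iterate agrees with its solution to order 3 n. *)
Fixpoint branch_unit (F : nzRingType) n : {poly F} :=
  if n is m.+1 then 1 + 'X^3 * branch_unit F m ^+ 3 else 0.
Definition branch (F : nzRingType) n : {poly F} := 'X^2 * branch_unit F n.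

Lemma mulf_div_inv (L : fieldType) (a c : L) :
  a != 0 -> c != 0 -> (a / c) * (c / a) = 1.
Proof. by move=> a0 c0; rewrite mulrA divfK // divff. Qed.

Lemma cubic_eqn (L : fieldType) (a b c n : L) : a != 0 -> c != 0 ->
    a * b * c = n + a ^+ 3 + b ^+ 3 ->
  b / c = (a / c) ^+ 2 + (b / c) ^+ 3 * (c / a) + n / (c ^+ 2 * a).
Proof.
move=> a0 c0 E; have -> : n = a * b * c - a ^+ 3 - b ^+ 3 by rewrite E; ring.
by field; rewrite a0 c0.
Qed.

(** The iteration contracts: the distance of Y to the next iterate is the previous
    distance times a function of positive order, up to nu, which measures how far
    (X, Y) is from the cubic. *)
Lemma branch_contraction (L : fieldType) (X Y u nu W : L) : X * u = 1 ->
    Y = X ^+ 2 + Y ^+ 3 * u + nu ->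
  Y - X ^+ 2 * (1 + X ^+ 3 * W ^+ 3) =
    (Y - X ^+ 2 * W) * (Y ^+ 2 + Y * (X ^+ 2 * W) + (X ^+ 2 * W) ^+ 2) * u + nu.
Proof.
move=> Xu YE; rewrite {1}YE.
have -> : (Y - X ^+ 2 * W) * (Y ^+ 2 + Y * (X ^+ 2 * W) + (X ^+ 2 * W) ^+ 2) * u
  = Y ^+ 3 * u - X ^+ 5 * W ^+ 3 * (X * u) by ring.
by rewrite Xu; ring.
Qed.

Section PencilOrders.
Variables (F : fieldType) (M : nat) (x y z : {poly F}).
Hypothesis M_gt0 : (0 < M)%N.
Hypothesis cubicE : x * y * z = 'X + x ^+ 3 + y ^+ 3.
Hypothesis size_x : size x = (ofib M * fib M.*2).+1.
Hypothesis size_y : size y = (ofib M * fib M.-1.*2).+1.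
Local Notation "p %:F" := (tofrac p).
Local Notation o := (ofib M).
Local Notation o' := (ofib M.+1).

Lemma fib_pred : (fib M.-1.*2 + o = fib M.*2)%N.
Proof. by rewrite -{2 3}(prednK M_gt0) fib_odd_even. Qed.

Lemma fib_o' : (fib M.*2 + o = o')%N.
Proof. exact: fib_even_odd. Qed.

Lemma x_neq0 : x != 0. Proof. by rewrite -size_poly_eq0 size_x. Qed.
Lemma y_neq0 : y != 0. Proof. by rewrite -size_poly_eq0 size_y. Qed.

Lemma size_cube (p : {poly F}) n : size p = n.+1 -> size (p ^+ 3) = (3 * n).+1.
Proof.
move=> sp; have p0 : p != 0 by rewrite -size_poly_eq0 sp.
have := size_exp p 3; rewrite sp succnK mulnC => <-.
by rewrite prednK ?size_poly_gt0 ?expf_neq0.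
Qed.

Lemma size_cubic : size ('X + x ^+ 3 + y ^+ 3) = (3 * (o * fib M.*2)).+1.
Proof.
have := ofib_gt0 M; have := fib_pred => fp o0.
have sx := size_cube size_x; have sy := size_cube size_y.
rewrite size_polyDl addrC size_polyDl ?sx ?sy ?size_polyX //.
- by rewrite !ltnS; nia.
- by rewrite -fp; nia.
- by rewrite !ltnS; nia.
Qed.

Lemma z_neq0 : z != 0.
Proof.
have : x * y * z != 0 by rewrite cubicE -size_poly_eq0 size_cubic.
by rewrite mulf_eq0 negb_or => /andP[].
Qed.

Lemma size_z : size z = (o * o').+1.
Proof.
have := congr1 (fun p : {poly F} => (size p)%:Z) cubicE.
rewrite size_cubic !size_mulz ?mulf_neq0 ?x_neq0 ?y_neq0 ?z_neq0 //.
rewrite size_x size_y -fib_o' -fib_pred.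
move: (size z) (ofib M) (fib M.-1.*2) => s a b; nia.
Qed.

Local Notation X := (x%:F / z%:F).
Local Notation Y := (y%:F / z%:F).

Lemma ord_X : ord_inf (o * o)%:Z X.
Proof.
apply: ord_inf_frac; first exact: z_neq0.
by rewrite size_x size_z -fib_o'; nia.
Qed.

Lemma ord_Y : ord_inf (2 * (o * o))%:Z Y.
Proof.
apply: ord_inf_frac; first exact: z_neq0.
by rewrite size_y size_z -fib_o' -fib_pred; nia.
Qed.

Lemma ord_invX : ord_inf (- (o * o)%:Z) (z%:F / x%:F).
Proof.
apply: ord_inf_frac; first exact: x_neq0.
by rewrite size_x size_z -fib_o'; nia.
Qed.

(** The degrees give the order 3 o o' - o^2 - 1, which is o'^2 by the Markov
    equation. *)
Lemma ord_residue : ord_inf (o' * o')%:Z (tofrac 'X / (z ^+ 2 * x)%:F).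
Proof.
have z0 := z_neq0; have x0 := x_neq0.
apply: ord_inf_frac; first by rewrite mulf_neq0 // expf_neq0.
rewrite expr2 !size_mulz ?mulf_neq0 // size_polyX size_z size_x.
have := markov M; rewrite -fib_o'.
by move: (ofib M) (fib M.*2) => a b; nia.
Qed.

(** Each iteration gains at least one order, until the defect of the curve from the
    cubic is reached. *)
Lemma ord_branch n :
  ord_inf (minn (o' * o') n)%:Z (Y - ev1 (@const F) X (branch F n)).
Proof.
have z0 : z%:F != 0 by rewrite tofrac_eq0 z_neq0.
have x0 : x%:F != 0 by rewrite tofrac_eq0 x_neq0.
have OP := filtration_inf F.
elim: n => [|n IH].
  rewrite (_ : ev1 _ _ _ = 0) ?subr0 ?minn0; last by rewrite /branch /= mulr0 ev1_0.
  by apply: ord_infW ord_Y.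
pose W := ev1 (@const F) X (branch_unit F n).
have bE m : ev1 (@const F) X (branch F m) =
    X ^+ 2 * ev1 (@const F) X (branch_unit F m).
  by rewrite /branch ev1M ev1Xn ev1X.
have YE : Y = X ^+ 2 + Y ^+ 3 * (z%:F / x%:F) + tofrac 'X / (z ^+ 2 * x)%:F.
  rewrite [(z ^+ 2 * x)%:F]tofracM [(z ^+ 2)%:F]tofracXn; apply: (cubic_eqn x0 z0).
  rewrite -(tofracM x y) -(tofracM (x * y) z) cubicE.
  rewrite (tofracD ('X + x ^+ 3) (y ^+ 3)) (tofracD 'X (x ^+ 3)).
  by rewrite [(x ^+ 3)%:F]tofracXn [(y ^+ 3)%:F]tofracXn.
have -> : Y - ev1 (@const F) X (branch F n.+1) =
    (Y - ev1 (@const F) X (branch F n))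
      * (Y ^+ 2 + Y * (X ^+ 2 * W) + (X ^+ 2 * W) ^+ 2) * (z%:F / x%:F)
      + tofrac 'X / (z ^+ 2 * x)%:F.
  rewrite !bE [branch_unit F n.+1]/(1 + _) ev1D ev1_1 ev1M !ev1Xn ev1X -/W.
  apply: branch_contraction YE.
  exact: (mulf_div_inv x0 z0).
have O2 : ord_inf (2 * (o * o))%:Z (X ^+ 2 * W).
  rewrite -[(2 * _)%N]addn0; apply: (filtM OP); first exact: (filtX OP _ ord_X).
  rewrite /W -(evC _ X Y); apply: (filt_ev (a := 0) (b := 0) OP) => //.
    by apply: ord_infW ord_X.
  by apply: ord_infW ord_Y.
apply: ord_infD; last by apply: ord_infW ord_residue; rewrite lez_nat geq_minl.
have O4 : ord_inf (4 * (o * o))%:Z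
    (Y ^+ 2 + Y * (X ^+ 2 * W) + (X ^+ 2 * W) ^+ 2).
  have -> : (4 * (o * o) = 2 * (2 * (o * o)))%N by lia.
  apply: ord_infD; last exact: (filtX OP _ O2).
  apply: ord_infD; first exact: (filtX OP _ ord_Y).
  by rewrite mul2n -addnn PoszD; apply: ord_infM O2; exact: ord_Y.
apply: ord_infW (ord_infM (ord_infM IH O4) ord_invX).
have := ofib_gt0 M; rewrite -/o; nia.
Qed.

(** f restricted to the curve is a polynomial of degree at most d o o' divided by
    z^d; if it is not zero, its order at infinity is at most d o o'. *)
Lemma pencil_order (f : {poly {poly F}}) d K N0 : tdeg d f ->
    (homog d f x y z).[N0] != 0 ->
    (forall i j, shift_coef (fun k => (branch F (o' * o'))`_k) f i j != 0 ->
      (K <= o * o * i + o' * o' * j)%N) ->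
  (K <= d * (o * o'))%N.
Proof.
move=> fd g0 fK.
have z0 : z%:F != 0 by rewrite tofrac_eq0 z_neq0.
have := filt_shift_coef (filtration_inf F) ord_X _ fK.
move=> /(_ Y); have := ord_branch (o' * o'); rewrite minnn => h /(_ h) {h}.
have E := @ev_homog F _ (@const F) (@tofrac _) d f x y z (fun=> erefl) fd z0.
rewrite [ev _ _ _ _]E -[_ ^+ d]tofracXn => /ord_inf_le; have g1 : homog d f x y z != 0.
  by apply: contraNneq g0 => ->; rewrite horner0.
move=> /(_ g1 (expf_neq0 _ z_neq0)).
have := size_exp z d; rewrite size_z succnK.
have : (0 < size (homog d f x y z))%N by rewrite size_poly_gt0.
have : (0 < size (z ^+ d))%N by rewrite size_poly_gt0 expf_neq0 // z_neq0.
move: (size _) (size _) => a b; nia.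
Qed.
End PencilOrders.

Lemma exists_nonroot (F : idomainType) (s : nat -> F) (p : {poly F}) :
  injective s -> p != 0 -> exists n, p.[s n] != 0.
Proof.
move=> s_inj p0; have [/allP roots|/allPn[_ /mapP[n _ ->] sn]] :=
    boolP (all (root p) [seq s n | n <- iota 0 (size p)]).
  have := max_poly_roots p0 (introT allP roots).
  by rewrite map_inj_uniq ?iota_uniq // size_map size_iota ltnn => /(_ isT).
by exists n.
Qed.

Lemma min_shift_coef (F : fieldType) (xi : nat -> F) f a b : f != 0 ->
  exists i j, shift_coef xi f i j != 0 /\
    forall i' j', shift_coef xi f i' j' != 0 ->
      (a * i + b * j <= a * i' + b * j')%N.
Proof.
move=> f0; have [i0 [j0 nz0]] := shift_coef_neq0 xi f0.
pose P K := `[< exists i j, shift_coef xi f i j != 0 /\ K = (a * i + b * j)%N >].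
have exP : exists K, P K.
  by exists (a * i0 + b * j0)%N; apply/asboolP; exists i0, j0.
case: (ex_minnP exP) => K /asboolP[i [j [nz ->]]] Kmin.
exists i, j; split=> // i' j' nz'; apply: Kmin; apply/asboolP.
by exists i', j'.
Qed.

(** The member of the pencil is chosen through a point outside f = 0.  Points with
    coordinates between 1/5 and 1/4 have x y > x^3 + y^3, hence N > 0, and there
    are enough of them to leave f = 0. *)
Theorem pencil_bound (R : realType) M : (0 < M)%N ->
  exists q : {poly R[i]}, q`_0 = 0 /\
    forall d f, f != 0 -> tdeg d f ->
    exists i j, shift_coef (fun k => q`_k) f i j != 0 /\
      (ofib M * ofib M * i + ofib M.+1 * ofib M.+1 * j
         <= d * (ofib M * ofib M.+1))%N.
Proof.
move=> M0; pose q : {poly R[i]} := branch _ (ofib M.+1 * ofib M.+1).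
exists q; split; first by rewrite /q /branch coefXnM.
move=> d f f0 fd.
have [i [j [nz min]]] :=
  min_shift_coef (fun k => q`_k) (ofib M * ofib M) (ofib M.+1 * ofib M.+1) f0.
exists i, j; split=> //.
pose r n : R := 4^-1 - (n + 20)%:R^-1.
pose s n : R[i] := (r n)%:C%C.
have r_inj : injective r.
  by move=> m n /addrI /oppr_inj /invr_inj /eqP; rewrite eqr_nat eqn_add2r => /eqP.
have s_inj : injective s by move=> m n [] /r_inj.
have rP n : 5^-1 <= r n < 4^-1.
  have n20 : 20%:R <= (n + 20)%:R :> R by rewrite ler_nat leq_addl.
  have n0 : 0 < (n + 20)%:R :> R by lra.
  rewrite /r; have : (n + 20)%:R^-1 <= 20%:R^-1 :> R by rewrite lef_pV2 ?posrE.
  have : 0 < (n + 20)%:R^-1 :> R by rewrite invr_gt0.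
  by lra.
have lf0 : lead_coef f != 0 by rewrite lead_coef_eq0.
have [m xm] := exists_nonroot s_inj lf0.
have g0 : map_poly (ev1 idfun (s m)) f != 0.
  apply: contraNneq xm => g0; have := congr1 (fun p : {poly R[i]} => p`_(size f).-1) g0.
  rewrite coef_map coef0 -lead_coefE /= /ev1 /= /horner_eval map_poly_id // => ->.
  by rewrite eqxx.
have [n yn] := exists_nonroot s_inj g0.
pose N : R := r m * r n - r m ^+ 3 - r n ^+ 3.
have N0 : 0 < N.
  rewrite /N; have /andP[m1 m2] := rP m; have /andP[n1 n2] := rP n.
  move: (r m) (r n) m1 m2 n1 n2 => a b a1 a2 b1 b2.
  have : a ^+ 3 <= 64^-1.
    by rewrite (_ : 64^-1 = 4^-1 ^+ 3); [rewrite lerXn2r ?nnegrE; lra|field].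
  have : b ^+ 3 <= 64^-1.
    by rewrite (_ : 64^-1 = 4^-1 ^+ 3); [rewrite lerXn2r ?nnegrE; lra|field].
  by nra.
have pos (a : R) : 0 < a -> 0 < (a%:C)%C by rewrite -(ltcR 0 a).
have sm0 : 0 < s m by apply: pos; have := rP m; lra.
have sn0 : 0 < s n by apply: pos; have := rP n; lra.
have [|x [y [z [[xv yv zv] cub sx sy]]]] := pencil_member sm0 sn0 (pos _ N0) M0.
  by rewrite /s /N -!rmorphXn -rmorphM -!rmorphD; congr (_%:C)%C; ring.
apply: (pencil_order M0 cub sx sy fd) min.
instantiate (1 := (N%:C)%C).
have z1 : horner_eval (N%:C)%C z != 0 by rewrite /horner_eval zv oner_eq0.
have := ev_homog (psi := horner_eval (N%:C)%C) (iota := idfun) x y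
  (fun c => hornerC c _) fd z1.
rewrite /= /horner_eval xv yv zv expr1n !divr1 => <-.
by rewrite /ev /= /horner_eval.
Qed.

(** * The nodal cubic *)

Definition nodal (A : comNzRingType) : {poly {poly A}} :=
  ('X)%:P * 'X - ('X^3)%:P - 'X^3.

(** Division by the nodal cubic, which is monic in y up to sign, keeps track of the
    total degree: reducing y^3 to x y - x^3 does not raise it. *)
Definition divides_out (A : comNzRingType) d (f : {poly {poly A}}) : Prop :=
  exists h r : {poly {poly A}}, [/\ f = nodal A * h + r, (size r <= 3)%N &
    forall i j, h`_j`_i != 0 -> (i + j + 3 <= d)%N].

Lemma divides_outD (A : comNzRingType) d (f g : {poly {poly A}}) :
  divides_out d f -> divides_out d g -> divides_out d (f + g).
Proof.
move=> [h1 [r1 [-> s1 d1]]] [h2 [r2 [-> s2 d2]]].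
exists (h1 + h2), (r1 + r2); split; first by ring.
  by rewrite (leq_trans (size_polyD _ _)) // geq_max s1.
move=> i j; rewrite !coefD; have [->|/d1 //] := eqVneq (h1`_j`_i) 0.
by rewrite add0r => /d2.
Qed.

Lemma divides_out_monomial (A : comNzRingType) d (c : A) i j : (i + j <= d)%N ->
  divides_out d (c%:P *: monomial A (i, j)).
Proof.
elim/ltn_ind: j c i => j IH c i ijd.
have [j3|j3] := ltnP j 3.
  exists 0, (c%:P *: monomial A (i, j)); split; first by rewrite mulr0 add0r.
    apply/leq_sizeP => k k3; rewrite coefZ /monomial coefCM coefXn /=.
    by rewrite (_ : (k == j) = false) ?mulr0 //; lia.
  by move=> a b; rewrite !coef0 eqxx.
have [k jE] : exists k, j = (k + 3)%N by exists (j - 3)%N; lia.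
have -> : c%:P *: monomial A (i, j) =
    (nodal A * (- (c%:P *: monomial A (i, k))) + c%:P *: monomial A (i.+1, k.+1))
    + (- c)%:P *: monomial A (i + 3, k)%N.
  rewrite -!mul_polyC /monomial /= jE !exprD !exprS /nodal !polyCN !polyCM.
  ring.
apply: divides_outD; last by apply: IH; lia.
apply: divides_outD; last by apply: IH; lia.
exists (- (c%:P *: monomial A (i, k))), 0; split; first by rewrite addr0.
  by rewrite size_poly0.
move=> a b; rewrite !coefN oppr_eq0 coefZ coefCM coef_monomial.
case: ((a, b) =P (i, k)) => [[-> ->] _|_]; last by rewrite mulr0 eqxx.
by move: ijd; rewrite jE addnA.
Qed.

Lemma divides_outP (A : comNzRingType) d (f : {poly {poly A}}) :
  tdeg d f -> divides_out d f.
Proof.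
move=> /form_ofP[u ->]; rewrite /form_of.
have P0 : divides_out d (0 : {poly {poly A}}).
  exists 0, 0; split; rewrite ?size_poly0 ?mulr0 ?addr0 //.
  by move=> a b; rewrite !coef0 eqxx.
elim/big_ind : _ => // [f1 f2|k _]; first exact: divides_outD.
have : nth (0, 0)%N (monomials d) k \in monomials d by rewrite mem_nth.
by case: (nth _ _ _) => i j; rewrite mem_monomials; exact: divides_out_monomial.
Qed.

Section Remainder.
Variable C : numClosedFieldType.

(** The line x = n + 1 meets the cubic in three distinct points: the discriminant
    c^3 (4 - 27 c^3) of y^3 - c y + c^3 does not vanish at a positive integer c. *)
Lemma cubic_roots n : let c : C := n.+1%:R in
  exists rs : seq C, [/\ size rs = 3%N, uniq rs &
    forall y, y \in rs -> y ^+ 3 = c * y - c ^+ 3].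
Proof.
move=> c; have c0 : c != 0 by rewrite pnatr_eq0.
pose p : {poly C} := 'X^3 + (- c *: 'X + (c ^+ 3)%:P).
have sp : size p = 4%N.
  rewrite size_polyDl size_polyXn // (leq_ltn_trans (size_polyD _ _)) //.
  rewrite gtn_max (leq_ltn_trans (size_scale_leq _ _)) ?size_polyX //.
  by rewrite (leq_ltn_trans (size_polyC_leq1 _)).
have pm : lead_coef p = 1.
  by rewrite lead_coefE sp /p !(coefD, coefXn, coefZ, coefX, coefC) /= mulr0 !addr0.
have [rs rsE] := closed_field_poly_normal p; rewrite pm scale1r in rsE.
have pE y : p.[y] = y ^+ 3 - c * y + c ^+ 3.
  by rewrite /p !(hornerD, hornerZ, hornerXn, hornerX, hornerC); ring.
exists rs; split.
- by have := size_prod_XsubC rs id; rewrite -rsE sp => -[].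
- rewrite -(separable_prod_XsubC rs) -rsE separable.separable_poly.unlock.
  apply/Pdiv.ClosedField.coprimepP => y /rootP; rewrite pE => yE.
  have -> : p^`() = 3%:R *: 'X^2 - c%:P.
    rewrite /p !(derivD, derivXn, derivZ, derivX, derivC) /= addr0.
    by rewrite scaleNr alg_polyC scaler_nat.
  rewrite hornerD hornerN hornerZ hornerXn hornerC; apply/negP.
  rewrite subr_eq0 => /eqP dE.
  have y2 : 2 * y = 3 * c ^+ 2.
    apply: (mulfI c0); apply/eqP; rewrite -subr_eq0; apply/eqP.
    transitivity (- 3 * (y ^+ 3 - c * y + c ^+ 3) + y * (3 * y ^+ 2 - c)).
      by ring.
    by rewrite yE dE subrr !mulr0 addr0.
  have : 27 * c ^+ 3 = 4.
    apply: (mulfI c0); transitivity (3 * (3 * c ^+ 2) ^+ 2); first by ring.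
    by rewrite -y2 -[in RHS]dE; ring.
  move=> /eqP; rewrite /c -natrX -natrM eqr_nat => /eqP; lia.
- move=> y; rewrite -root_prod_XsubC -rsE => /rootP; rewrite pE => yE.
  by apply/eqP; rewrite -subr_eq0; apply/eqP; rewrite -[RHS]yE; ring.
Qed.

(** A polynomial that vanishes on the parametrization
    s |-> (s : s^2 : 1 + s^3) of the nodal cubic is a multiple of it: the remainder
    has degree at most 2 in y, and three zeros on each line x = n + 1. *)
Lemma nodal_remainder d f : tdeg d f ->
    homog d f 'X 'X^2 (1 + 'X^3 : {poly C}) = 0 ->
  exists h, f = nodal C * h /\ forall i j, h`_j`_i != 0 -> (i + j + 3 <= d)%N.
Proof.
move=> fd f0; have [h [r [fE sr hd]]] := divides_outP fd.
exists h; split=> //; rewrite fE (_ : r = 0) ?addr0 //.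
have rc n : map_poly (ev1 idfun (n.+1%:R : C)) r = 0.
  have [rs [srs urs rsP]] := cubic_roots n; set c := n.+1%:R in rsP *.
  have c0 : c != 0 :> C by rewrite pnatr_eq0.
  clearbody c.
  apply/eqP; apply: contraT => rn0.
  have := max_poly_roots rn0 _ urs; rewrite srs.
  suff /[swap] /[apply] : all (root (map_poly (ev1 idfun c) r)) rs.
    by rewrite ltnNge (leq_trans (size_poly _ _)).
  apply/allP => y /rsP yE; apply/rootP.
  have y0 : y != 0.
    apply: contraNneq c0 => y0; move: yE; rewrite y0 expr0n mulr0 sub0r => /esym/eqP.
    by rewrite oppr_eq0 expf_eq0.
  pose s := y / c.
  have wE : 1 + s ^+ 3 = y / c ^+ 2.
    by rewrite /s expr_div_n yE; field.
  have w0 : horner_eval s (1 + 'X^3) != 0.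
    rewrite /horner_eval hornerD hornerC hornerXn wE mulf_neq0 ?invr_eq0 //.
    by rewrite expf_neq0.
  have := ev_homog (psi := horner_eval s) (iota := idfun) 'X 'X^2
    (fun c => hornerC c _) fd w0.
  rewrite f0 /= /horner_eval horner0 mul0r hornerD hornerC !hornerXn hornerX wE.
  have -> : s / (y / c ^+ 2) = c by rewrite /s; field; rewrite y0 c0.
  have -> : s ^+ 2 / (y / c ^+ 2) = y by rewrite /s; field; rewrite y0 c0.
  have nodal0 : ev idfun c y (nodal C) = 0.
    by rewrite /nodal !evB evM !evC evXn evX ev1Xn ev1X yE; ring.
  by rewrite fE evD evM nodal0 mul0r add0r.
apply/polyP => j; apply/eqP; rewrite coef0; apply: contraT => rj.
have s_inj : injective (fun n => n.+1%:R : C).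
  by move=> m n /eqP; rewrite eqr_nat eqSS => /eqP.
have [n /negP[]] := exists_nonroot s_inj rj.
have := congr1 (fun p : {poly C} => p`_j) (rc n).
by rewrite coef_map coef0 /= /ev1 /= /horner_eval map_poly_id // => ->.
Qed.
End Remainder.

(** The branch of the nodal cubic is y = x^2 + x^5 + 3 x^8 + ..., so this curve
    meets it to order exactly 7. *)
Definition special_branch (F : fieldType) : {poly F} := 'X^2 + 'X^5 + 'X^7.

Section Bezout.
Variable F : fieldType.
Local Notation "p %:F" := (tofrac p).
Local Notation w := (1 + 'X^3 : {poly F}).
Local Notation X := (('X : {poly F})%:F / w%:F).
Local Notation Y := (('X^2 : {poly F})%:F / w%:F).
Local Notation q := (special_branch F).

Lemma size_w : size w = 4%N.
Proof. by rewrite addrC size_polyDl size_polyXn // size_poly1. Qed.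

Lemma w_neq0 : w != 0.
Proof. by rewrite -size_poly_eq0 size_w. Qed.

Lemma w0_neq0 : w.[0] != 0.
Proof. by rewrite hornerD hornerC hornerXn expr0n addr0 oner_neq0. Qed.

Lemma ev1_special (L : fieldType) (iota : {rmorphism F -> L}) Z :
  ev1 iota Z q = Z ^+ 2 + Z ^+ 5 + Z ^+ 7.
Proof. by rewrite /special_branch !ev1D !ev1Xn ev1X. Qed.

Lemma branch_contact (L : fieldType) (s v : L) : v != 0 -> v = 1 + s ^+ 3 ->
  s ^+ 2 / v - ((s / v) ^+ 2 + (s / v) ^+ 5 + (s / v) ^+ 7) =
  s ^+ 7 * (s * v ^+ 2 * (3 + 3 * s ^+ 3 + s ^+ 6) - 1) / v ^+ 7.
Proof.
move=> v0 vE.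
have -> : s ^+ 7 * (s * v ^+ 2 * (3 + 3 * s ^+ 3 + s ^+ 6) - 1) =
    s ^+ 2 * v ^+ 6 - s ^+ 2 * v ^+ 5 - s ^+ 5 * v ^+ 2 - s ^+ 7.
  by rewrite vE; ring.
by field.
Qed.

Lemma ord_zero_X : ord_zero 1 X.
Proof. by exists 1, w; rewrite w0_neq0 mulr1 expr1. Qed.

Lemma ord_zero_branch : ord_zero 7 (Y - ev1 (@const F) X q).
Proof.
have wF : w%:F != 0 by rewrite tofrac_eq0 w_neq0.
exists ('X * w ^+ 2 * (3 + 3 * 'X^3 + 'X^6) - 1), (w ^+ 7).
split; first by rewrite horner_exp expf_neq0 // w0_neq0.
rewrite ev1_special.
have wE : w%:F = 1 + ('X : {poly F})%:F ^+ 3.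
  by rewrite -tofracXn -tofrac1 -tofracD.
have -> : ('X^2 : {poly F})%:F = ('X : {poly F})%:F ^+ 2 by rewrite -tofracXn.
rewrite (branch_contact wF wE) [(w ^+ 7)%:F]tofracXn; congr (_ / _).
by rewrite !(rmorphM, rmorphB, rmorphD, rmorphXn, rmorph1, rmorph_nat).
Qed.

Lemma ord_inf_X : ord_inf 1 X.
Proof. by apply: ord_inf_frac; rewrite ?w_neq0 // size_polyX size_w. Qed.

Lemma ord_inf_branch : ord_inf 1 (Y - ev1 (@const F) X q).
Proof.
have OP := filtration_inf F.
apply: ord_infD.
  by apply: ord_inf_frac; rewrite ?w_neq0 // size_polyXn size_w.
have -> : - ev1 (@const F) X q = const (-1) * ev1 (@const F) X q.
  by rewrite rmorphN rmorph1 mulN1r.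
rewrite -[X in ord_inf X _]add0r.
apply: ord_infM; first exact: ord_inf_const.
have H n : (0 < n)%N -> ord_inf 1 (X ^+ n).
  move=> n0; have := filtX OP n (ord_inf_X : (fun k : nat => ord_inf k%:Z) 1%N X).
  by apply: ord_infW; rewrite muln1 lez_nat.
rewrite ev1_special; apply: ord_infD; last exact: H.
by apply: ord_infD; exact: H.
Qed.

(** The two branches of the cubic at its node are s = 0, meeting the special
    branch to order 7, and s = oo, transversal to it.  The 3 d zeros of f on the
    cubic bound the sum of its orders at these two places. *)
Lemma nodal_bezout d f : f != 0 -> tdeg d f -> homog d f 'X 'X^2 w != 0 ->
  exists i0 j0 i1 j1, [/\ shift_coef (fun k => q`_k) f i0 j0 != 0,
    shift_coef (fun k => q`_k) f i1 j1 != 0 &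
    (i0 + 7 * j0 + (i1 + j1) <= 3 * d)%N].
Proof.
move=> f0 fd g0.
have [i0 [j0 [nz0 min0]]] := min_shift_coef (fun k => q`_k) 1 7 f0.
have [i1 [j1 [nz1 min1]]] := min_shift_coef (fun k => q`_k) 1 1 f0.
exists i0, j0, i1, j1; split=> //.
have wF : w%:F != 0 by rewrite tofrac_eq0 w_neq0.
have E := @ev_homog F _ (@const F) (@tofrac _) d f 'X 'X^2 w (fun=> erefl) fd wF.
have := filt_shift_coef (filtration_zero F) ord_zero_X ord_zero_branch min0.
rewrite [ev _ _ _ _]E -[_ ^+ d]tofracXn => /ord_zero_dvd.
move=> /(_ _)/dvdp_leq; rewrite horner_exp expf_neq0 ?w0_neq0 // => /(_ g0 isT).
have := filt_shift_coef (filtration_inf F) ord_inf_X ord_inf_branch min1.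
rewrite [ev _ _ _ _]E -[_ ^+ d]tofracXn => /(ord_inf_le g0 (expf_neq0 _ w_neq0)).
rewrite size_polyXn; have := size_exp w d; rewrite size_w.
have : (0 < size (w ^+ d))%N by rewrite size_poly_gt0 expf_neq0 // w_neq0.
by move: (size _) (size _) => a b; lia.
Qed.
End Bezout.

Section Leading.
Variables (R : realType) (t : R).
Hypothesis t1 : 1 <= t.
Local Notation weight i j := (i%:R + t * j%:R).

Lemma weight_bound i j (m : nat) : weight i j <= m%:R -> (i <= m)%N /\ (j <= m)%N.
Proof.
have i0 : 0 <= i%:R :> R by [].
have j0 : 0 <= j%:R :> R by [].
have tj : j%:R <= t * j%:R by rewrite ler_peMl.
by move=> ijm; rewrite -!(ler_nat R); split; lra.
Qed.

Lemma min_weight (p : nat -> nat -> bool) i0 j0 : p i0 j0 ->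
  exists i j, [/\ p i j, weight i j <= weight i0 j0 &
    forall a b, p a b -> weight i j <= weight a b].
Proof.
move=> p0; pose m := (Num.truncn (weight i0 j0)).+1.
have wm : weight i0 j0 <= m%:R by apply: ltW; exact: truncnS_gt.
have [i0m j0m] := weight_bound wm.
pose x0 : 'I_m.+1 * 'I_m.+1 := (inord i0, inord j0).
pose W (x : 'I_m.+1 * 'I_m.+1) : R := weight x.1 x.2.
have x0P : p x0.1 x0.2 by rewrite /= !inordK.
case: (@arg_minP _ R _ x0 (fun x => p x.1 x.2) W x0P) => -[i j] /= pij ijmin.
have le0 : weight i j <= weight i0 j0.
  by have := ijmin x0 x0P; rewrite /W /= !inordK.
exists i, j; split=> // a b pab.
have [wab|/ltW wab] := leP (weight a b) m%:R; last first.
  by apply: le_trans wab; apply: le_trans wm.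
have [am bm] := weight_bound wab.
have := ijmin (inord a, inord b); rewrite /W /= !inordK //; exact.
Qed.

(** A product keeps the product of the leading terms when one factor has a unique
    monomial of least weight. *)
Lemma shift_coef_mul_min (F : idomainType) (xi : nat -> F) f g i0 j0 i j :
    shift_coef xi f i0 j0 != 0 ->
    (forall a b, shift_coef xi f a b != 0 -> (a, b) != (i0, j0) ->
       weight i0 j0 < weight a b) ->
    shift_coef xi g i j != 0 ->
    (forall a b, shift_coef xi g a b != 0 -> weight i j <= weight a b) ->
  shift_coef xi (f * g) (i0 + i) (j0 + j) != 0.
Proof.
move=> f0 fmin g0 gmin; rewrite shift_coefM.
have jl : (j0 < (j0 + j).+1)%N by rewrite ltnS leq_addr.
have il : (i0 < (i0 + i).+1)%N by rewrite ltnS leq_addr.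
have other a b : (a <= i0 + i)%N -> (b <= j0 + j)%N -> (a, b) != (i0, j0) ->
    shift_coef xi f a b * shift_coef xi g (i0 + i - a) (j0 + j - b) = 0.
  move=> ai bj ab; apply/eqP; apply: contraT; rewrite mulf_eq0 negb_or.
  move=> /andP[/fmin/(_ ab) fab /gmin gab]; exfalso.
  move: fab gab; rewrite !natrB // !natrD; lra.
rewrite (bigD1 (Ordinal jl)) //= (bigD1 (Ordinal il)) //=.
rewrite !addKn [X in _ + X + _]big1 ?[X in _ + _ + X]big1 ?addr0 ?mulf_neq0 //.
- move=> b bj0; apply: big1 => a _.
  apply: (other a b (ltn_ord a) (ltn_ord b)).
  by apply: contraNneq bj0 => -[_ bE]; apply/eqP/val_inj.
- move=> a ai0; have := other a j0 (ltn_ord a) (leq_addr _ _).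
  rewrite addKn; apply.
  by apply: contraNneq ai0 => -[aE]; apply/eqP/val_inj.
Qed.

Variable c : R.
Hypothesis c0 : 0 <= c.
Local Notation xi := (fun k => (special_branch R[i])`_k).

(** Induction on the degree: either f is not a multiple of the nodal cubic and
    Bezout applies, or dividing by the cubic lowers the degree by 3 and the
    valuation by the weight of (a0, b0), its only monomial of least weight. *)
Lemma nodal_growth a0 b0 :
    (forall d i0 j0 i1 j1 : nat, (i0 + 7 * j0 + (i1 + j1) <= 3 * d)%N ->
       weight i0 j0 <= c * d%:R \/ weight i1 j1 <= c * d%:R) ->
    shift_coef xi (nodal _) a0 b0 != 0 ->
    (forall a b, shift_coef xi (nodal _) a b != 0 -> (a, b) != (a0, b0) ->
       weight a0 b0 < weight a b) ->
    weight a0 b0 <= 3 * c ->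
  forall d (f : {poly {poly R[i]}}), f != 0 -> tdeg d f ->
  exists i j, shift_coef xi f i j != 0 /\ weight i j <= c * d%:R.
Proof.
move=> bezout nz0 min0 le0; elim/ltn_ind => d IH f f0 fd.
have [hom0|homn0] := eqVneq (homog d f 'X 'X^2 (1 + 'X^3 : {poly R[i]})) 0;
  last first.
  have [i0 [j0 [i1 [j1 [nz0' nz1 /bezout[]]]]]] := nodal_bezout f0 fd homn0.
    by move=> le; exists i0, j0.
  by move=> le; exists i1, j1.
have [h [fE hd]] := nodal_remainder fd hom0.
have h0 : h != 0 by apply: contraNneq f0 => h0; rewrite fE h0 mulr0.
have d3 : (3 <= d)%N.
  have : lead_coef (lead_coef h) != 0 by rewrite !lead_coef_eq0.
  by rewrite [X in X != 0]lead_coefE [lead_coef h]lead_coefE => /hd; lia.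
have hd' : tdeg (d - 3) h by move=> i j /hd; lia.
have [|i [j [nzij leij]]] := IH (d - 3)%N _ h h0 hd'; first by lia.
have [i' [j' [nz' le' min']]] :=
  @min_weight (fun i j => shift_coef xi h i j != 0) i j nzij.
exists (a0 + i')%N, (b0 + j')%N; split.
  by rewrite fE; exact: shift_coef_mul_min.
by move: leij; rewrite !natrD natrB // => leij; lra.
Qed.
End Leading.

Section NodalCoefficients.
Variable F : fieldType.
Local Notation q := (special_branch F).
Local Notation u := ('X^3 + 'X^5 : {poly F}).

(** The expansion of the cubic along y = q(x), with q = x^2 (1 + u); its monomial
    of least weight is x Y for t < 7 and x^8 for t > 7. *)
Lemma nodal_shift : nodal F \Po ('X + q%:P) =
  ('X^8 * (1 - 'X * ((1 + 'X^2) * (3 + 3 * u + u ^+ 2))))%:P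
  + ('X * (1 - 3 * 'X^3 * (1 + u) ^+ 2))%:P * 'X
  + ('X^2 * (- 3 * (1 + u)))%:P * 'X^2 - 'X^3.
Proof.
rewrite /nodal !(comp_polyB, comp_polyM, comp_polyC, comp_polyX, comp_Xn_poly).
have qE : q = 'X^2 * (1 + u) by rewrite /special_branch; ring.
rewrite qE !(polyCM, polyCB, polyCD, polyCN, polyC1, polyC_exp, polyC_natr).
by rewrite ?polyC_natr; ring.
Qed.

Lemma nodal_coef i j : shift_coef (fun k => q`_k) (nodal F) i j != 0 ->
  [\/ (8 <= i)%N /\ j = 0%N, (1 <= i)%N /\ j = 1%N | (2 <= j)%N].
Proof.
rewrite shift_coef_poly nodal_shift.
case: j => [|[|j]]; last by move=> _; constructor 3.
- rewrite !(coefD, coefB, coefN, coefCM, coefC, coefXn, coefX) /=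
    ?(mulr0, mulr1, coef0, addr0, add0r, subr0, if_same)
    coefXnM ?(mulr0, mulr1, coef0, addr0, add0r, subr0, if_same).
  case: ltnP => [_|i8 _]; last by constructor 1.
  by rewrite eqxx.
- rewrite !(coefD, coefB, coefN, coefCM, coefC, coefXn, coefX) /=
    ?(mulr0, mulr1, coef0, addr0, add0r, subr0, if_same)
    coefXM ?(mulr0, mulr1, coef0, addr0, add0r, subr0, if_same).
  case: i => [|i _]; last by constructor 2.
  by rewrite /= eqxx.
Qed.

Lemma nodal_coef80 : shift_coef (fun k => q`_k) (nodal F) 8 0 = 1.
Proof.
rewrite shift_coef_poly nodal_shift.
rewrite !(coefD, coefB, coefN, coefCM, coefC, coefXn, coefX) /=
    ?(mulr0, mulr1, coef0, addr0, add0r, subr0, if_same) coefXnM /= coefB coefXM coef1.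
by rewrite ?(mulr0, mulr1, coef0, addr0, add0r, subr0, if_same).
Qed.

Lemma nodal_coef11 : shift_coef (fun k => q`_k) (nodal F) 1 1 = 1.
Proof.
rewrite shift_coef_poly nodal_shift.
rewrite !(coefD, coefB, coefN, coefCM, coefC, coefXn, coefX) /=
    ?(mulr0, mulr1, coef0, addr0, add0r, subr0, if_same) coefXM /= coefB coef1.
by rewrite mulrC mulrA coefMXn ?(mulr0, mulr1, coef0, addr0, add0r, subr0, if_same).
Qed.
End NodalCoefficients.

(** * The Fibonacci steps and the theorem *)

Lemma fibz_odd m : let i := m.*2.+1 in
  [/\ fibz (i%:Z - 2) = (ofib m)%:Z, fibz i%:Z = (ofib m.+1)%:Z
    & fibz (i%:Z + 2) = (ofib m.+2)%:Z].
Proof.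
split=> //; last by rewrite /fibz -PoszD addn2.
case: m => [|m]; first by [].
by rewrite (_ : _ - _ = (m.*2.+1)%:Z) // doubleS; lia.
Qed.

Lemma growth_le_trivial (R : realType) (t : R) : 1 <= t ->
  growth_le (fun=> 0 : R[i]) t t.
Proof.
move=> t1 d f f0 fd.
have lf : lead_coef (lead_coef f) != 0 by rewrite !lead_coef_eq0.
exists (size (lead_coef f)).-1, (size f).-1.
have nz : f`_(size f).-1`_(size (lead_coef f)).-1 != 0 by [].
split.
  have -> : (fun=> 0 : R[i]) = (fun k => (0 : {poly R[i]})`_k).
    by apply/funext => k; rewrite coef0.
  by rewrite shift_coef_poly addr0 comp_polyXr.
have := fd _ _ nz; rewrite -(ler_nat R) natrD.
move: (_.-1) (_.-1) => i j ij.
have i0 : 0 <= i%:R :> R by []. have j0 : 0 <= j%:R :> R by [].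
by nra.
Qed.

Lemma growth_le_mono (R : realType) xi (t s c : R) : t <= s ->
  growth_le xi s c -> growth_le xi t c.
Proof.
move=> ts gr d f f0 fd; have [i [j [nz le]]] := gr d f f0 fd.
exists i, j; split=> //; apply: le_trans le.
by rewrite lerD2l ler_wpM2r.
Qed.

(** Valuations divided by t are nonincreasing in t. *)
Lemma growth_le_scale (R : realType) (xi : nat -> R[i]) (t s c : R) : 0 < s -> s <= t ->
  growth_le xi s c -> growth_le xi t (t / s * c).
Proof.
move=> s0 st gr d f f0 fd; have [i [j [nz le]]] := gr d f f0 fd.
exists i, j; split=> //; rewrite -mulrA.
have ts : 1 <= t / s by rewrite ler_pdivlMr ?mul1r.
apply: le_trans (_ : t / s * (i%:R + s * j%:R) <= _); last first.
  by rewrite ler_wpM2l // (le_trans _ ts).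
by rewrite mulrDr mulrA divfK ?gt_eqF // lerD2r ler_peMl.
Qed.

(** The value at t = F_(2 m + 1)^2 / F_(2 m - 1)^2.  At t = 1, for m = 0, the pencil
    is replaced by the remark that a multiplicity is at most the degree. *)
Lemma growth_le_pencil (R : realType) m : exists xi : nat -> R[i], xi 0%N = 0 /\
  growth_le xi ((ofib m.+1)%:R ^+ 2 / (ofib m)%:R ^+ 2) ((ofib m.+1)%:R / (ofib m)%:R).
Proof.
case: m => [|m].
  exists (fun=> 0); split=> //; rewrite /= !expr1n divr1.
  by apply: growth_le_trivial.
have [q [q0 qP]] := pencil_bound R (ltn0Sn m).
exists (fun k => q`_k); split=> // d f f0 fd.
have [i [j [nz le]]] := qP d f f0 fd; exists i, j; split=> //.
have a0 : 0 < (ofib m.+1)%:R :> R by rewrite ltr0n ofib_gt0.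
have {}le : (ofib m.+1)%:R * (ofib m.+1)%:R * i%:R
    + (ofib m.+2)%:R * (ofib m.+2)%:R * j%:R
    <= d%:R * ((ofib m.+1)%:R * (ofib m.+2)%:R) :> R.
  by rewrite -!natrM -natrD ler_nat.
move: le; move: ((ofib m.+1)%:R : R) ((ofib m.+2)%:R : R) a0 => a b a0 le.
rewrite -(ler_pM2l (mulr_gt0 a0 a0)) mulrDr.
have -> : a * a * (b ^+ 2 / a ^+ 2 * j%:R) = b * b * j%:R by field; rewrite gt_eqF.
have -> : a * a * (b / a * d%:R) = d%:R * (a * b) by field; rewrite gt_eqF.
exact: le.
Qed.

Lemma ofib_mul m : (ofib m * ofib m.+2 = ofib m.+1 * ofib m.+1 + 1)%N.
Proof. by have := markov m; have := ofib_rec m; nia. Qed.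

Lemma leq_ofib m : (ofib m <= ofib m.+1)%N.
Proof. by rewrite -fib_even_odd leq_addl. Qed.

Lemma attains_ofib (R : realType) (xi : nat -> R[i]) (t v : R) m :
    0 <= v -> v <= (ofib m.+2)%:R -> v <= (ofib m)%:R * t ->
  attains xi t v (ofib m.+1).
Proof.
move=> v0 vq vp; apply: attains_triangle v0 vq vp; rewrite ?ofib_gt0 //.
  exact: ofib_mul.
exact: ofib_rec.
Qed.

(** Between two consecutive bounds of [growth_le_pencil], the left one, scaled, and
    the right one meet the valuation of a single curve, of degree b. *)
Lemma mu_hat_steps (R : realType) m (t : R) :
  let a : R := (ofib m)%:R in let b : R := (ofib m.+1)%:R in
  let c : R := (ofib m.+2)%:R in
  (b ^+ 2 / a ^+ 2 <= t <= c / a -> mu_hat t = a / b * t) /\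
  (c / a <= t <= c ^+ 2 / b ^+ 2 -> mu_hat t = c / b).
Proof.
move=> a b c.
have a0 : 0 < a by rewrite ltr0n ofib_gt0.
have b0 : 0 < b by rewrite ltr0n ofib_gt0.
have c0 : 0 < c by rewrite ltr0n ofib_gt0.
have ab : a <= b by rewrite ler_nat leq_ofib.
have bc : b <= c by rewrite ler_nat leq_ofib.
have s1 : 1 <= b ^+ 2 / a ^+ 2.
  by rewrite ler_pdivlMr ?exprn_gt0 // mul1r lerXn2r // nnegrE ltW.
have ca1 : 1 <= c / a by rewrite ler_pdivlMr // mul1r (le_trans ab).
split=> /andP[t1 t2].
  have t0 : 1 <= t by exact: le_trans t1.
  have tc : a * t <= c by move: t2; rewrite ler_pdivlMr // mulrC.
  apply: mu_hat_eq => //; first by rewrite mulr_ge0 ?divr_ge0 ?ltW //; lra.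
    have [xi [xi0 gr]] := growth_le_pencil R m; exists xi; split=> //.
    have s0 : 0 < b ^+ 2 / a ^+ 2 by lra.
    have := growth_le_scale s0 t1 gr; rewrite -/a -/b.
    by have -> : t / (b ^+ 2 / a ^+ 2) * (b / a) = a / b * t
      by field; rewrite !gt_eqF.
  exists (ofib m.+1); first exact: ofib_gt0.
  move=> xi _; have -> : a / b * t * (ofib m.+1)%:R = a * t.
    by rewrite -/b; field; rewrite gt_eqF.
  by apply: attains_ofib => //; rewrite mulr_ge0 ?ltW //; lra.
have t0 : 1 <= t by exact: le_trans t1.
apply: mu_hat_eq => //; first by rewrite divr_ge0 ?ltW.
  have [xi [xi0 gr]] := growth_le_pencil R m.+1; exists xi; split=> //.
  exact: growth_le_mono gr.
exists (ofib m.+1); first exact: ofib_gt0.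
move=> xi _; rewrite -/b divfK ?gt_eqF //.
apply: attains_ofib; [exact: ltW|exact: lexx|].
by rewrite -/a mulrC -ler_pdivrMr.
Qed.

Section NodalRange.
Variable R : realType.
Local Notation xi := (fun k => (special_branch R[i])`_k).

Lemma special_branch0 : (special_branch R[i])`_0 = 0.
Proof. by rewrite /special_branch !coefD !coefXn !addr0. Qed.

Lemma nodal_weights (t : R) a b : 1 <= t -> shift_coef xi (nodal _) a b != 0 ->
  [\/ (a = 8%N /\ b = 0%N) \/ (a = 1%N /\ b = 1%N), 9 <= a%:R + t * b%:R,
      2 + t <= a%:R + t * b%:R | 2 * t <= a%:R + t * b%:R].
Proof.
move=> t1 /nodal_coef[[a8 ->]|[a1 ->]|b2].
- have [->|a8'] := eqVneq a 8; first by constructor 1; left.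
  have : 9%:R <= a%:R :> R by rewrite ler_nat; lia.
  by constructor 2; rewrite mulr0 addr0.
- have [->|a1'] := eqVneq a 1; first by constructor 1; right.
  have : 2%:R <= a%:R :> R by rewrite ler_nat; lia.
  by constructor 3; rewrite mulr1; lra.
- have : 2%:R <= b%:R :> R by rewrite ler_nat.
  have : 0 <= a%:R :> R by [].
  by constructor 4; nra.
Qed.

(** If both witnesses of [nodal_bezout] had weight above (1 + t) d / 3, adding up
    would give 3 d > (1 + 1 / t) (1 + t) d / 3, that is (1 + t)^2 < 9 t. *)
Lemma growth_nodal_lt7 (t : R) : 1 < t < 7 -> 9 * t <= (1 + t) ^+ 2 ->
  growth_le xi t ((1 + t) / 3).
Proof.
move=> /andP[t1 t7] t9.
apply: (@nodal_growth R t _ _ _ 1 1); rewrite ?(ltW t1) //.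
- by lra.
- move=> d i0 j0 i1 j1; rewrite -(ler_nat R) !(natrD, natrM) => le.
  set v := (1 + t) / 3 * d%:R.
  have [?|v0] := leP (i0%:R + t * j0%:R) v; first by left.
  have [?|v1] := leP (i1%:R + t * j1%:R) v; first by right.
  exfalso; move: le v0 v1; rewrite /v.
  have : 0 <= i0%:R :> R by []. have : 0 <= j0%:R :> R by [].
  have : 0 <= i1%:R :> R by []. have : 0 <= j1%:R :> R by [].
  have : 0 <= d%:R :> R by [].
  move: (i0%:R : R) (j0%:R : R) (i1%:R : R) (j1%:R : R) (d%:R : R).
  move=> a b c e n n0 e0 c0 b0 a0 le v0 v1.
  have h0 : (1 + t) / 3 * n < a + 7 * b by nra.
  have h1 : (1 + t) / 3 * n < t * (c + e) by nra.
  have h2 : t * ((1 + t) / 3 * n) < t * (a + 7 * b) by rewrite ltr_pM2l //; lra.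
  have h3 : t * (a + 7 * b + (c + e)) <= t * (3 * n) by rewrite ler_pM2l //; lra.
  have h4 : 9 * t * n <= (1 + t) ^+ 2 * n by rewrite ler_wpM2r.
  by nra.
- by rewrite nodal_coef11 oner_neq0.
- move=> a b /(nodal_weights (ltW t1)) + ab.
  move=> [[[-> ->]|[aE bE]]|w|w|w]; rewrite ?mulr0 ?mulr1; try lra.
  by rewrite aE bE eqxx in ab.
- by rewrite mulr1; lra.
Qed.

Lemma growth_nodal_end : growth_le xi (64 / 9 : R) (8 / 3).
Proof.
have t1 : 1 <= 64 / 9 :> R by lra.
apply: (@nodal_growth R (64 / 9) _ _ _ 8 0) => //.
- by lra.
- move=> d i0 j0 i1 j1; rewrite -(ler_nat R) !(natrD, natrM) => le.
  have [?|v0] := leP (i0%:R + 64 / 9 * j0%:R) (8 / 3 * d%:R : R); first by left.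
  have [?|v1] := leP (i1%:R + 64 / 9 * j1%:R) (8 / 3 * d%:R : R); first by right.
  exfalso.
  have : 0 <= i0%:R :> R by []. have : 0 <= j0%:R :> R by [].
  have : 0 <= i1%:R :> R by []. have : 0 <= j1%:R :> R by [].
  by lra.
- by rewrite nodal_coef80 oner_neq0.
- move=> a b /(nodal_weights t1) + ab.
  move=> [[[aE bE]|[-> ->]]|w|w|w]; rewrite ?mulr0 ?mulr1; try lra.
  by rewrite aE bE eqxx in ab.
- by rewrite mulr0; lra.
Qed.

Lemma mu_hat_nodal (t c : R) : 1 <= t -> 0 <= c -> growth_le xi t c ->
  3 * c <= 8 -> 3 * c <= 1 + t -> mu_hat t = c.
Proof.
move=> t1 c0 gr c8 ct; apply: mu_hat_eq => //.
  by exists xi; split=> //; exact: special_branch0.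
exists 3%N => // xi' _; apply: attains_cubic => //; lra.
Qed.
End NodalRange.

Section GoldenRatio.
Variable R : realType.
Local Notation g := (((1 + Num.sqrt 5) / 2) ^+ 2 : R).

Lemma sqrt5 : Num.sqrt 5 ^+ 2 = 5 :> R.
Proof. by rewrite sqr_sqrtr. Qed.

Lemma sqrt5_bounds : 2 <= (Num.sqrt 5 : R) <= 3.
Proof.
have s0 : 0 <= Num.sqrt 5 :> R by exact: sqrtr_ge0.
by have := sqrt5; move: (Num.sqrt 5) s0 => s s0 s5; apply/andP; split; nra.
Qed.

Lemma golden_eq : g ^+ 2 = 3 * g - 1.
Proof.
have := sqrt5; move: (Num.sqrt 5) => s s5.
have -> : (((1 + s) / 2) ^+ 2) = (3 + s) / 2.
  by rewrite (_ : (_ / _) ^+ 2 = (1 + 2 * s + s ^+ 2) / 4); [rewrite s5|]; field.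
by rewrite (_ : (_ / _) ^+ 2 = (9 + 6 * s + s ^+ 2) / 4); [rewrite s5|]; field.
Qed.

Lemma golden_bounds : 2 <= g <= 4.
Proof.
have := sqrt5_bounds; have := sqrt5; move: (Num.sqrt 5) => s s5 /andP[s1 s2].
by apply/andP; split; nra.
Qed.

(** phi^2 F_(2 m - 1) - F_(2 m + 1) is divided by phi^2 at each step, hence stays
    positive and bounded, and the quotients F_(2 m + 1) / F_(2 m - 1) increase to
    phi^2. *)
Lemma golden_defect m : 0 < g * (ofib m)%:R - (ofib m.+1)%:R <= 3.
Proof.
have := golden_eq; have := golden_bounds; move: g => x /andP[x2 x4] xE.
elim: m => [|m /andP[IH1 IH2]]; first by rewrite /=; lra.
have : x * (x * (ofib m.+1)%:R - (ofib m.+2)%:R) = x * (ofib m)%:R - (ofib m.+1)%:R.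
  have : (ofib m)%:R + (ofib m.+2)%:R = 3 * (ofib m.+1)%:R :> R.
    by rewrite -natrM -natrD ofib_rec.
  move: ((ofib m)%:R : R) ((ofib m.+1)%:R : R) ((ofib m.+2)%:R : R) => a b c abc.
  have -> : c = 3 * b - a by rewrite -abc; ring.
  by rewrite mulrBr mulrA -expr2 xE; ring.
move=> E; move: IH1 IH2; rewrite -E.
move: (_ - _) => y y1 y2.
have y0 : 0 < y by rewrite -(pmulr_rgt0 _ (_ : 0 < x)) //; lra.
by apply/andP; split=> //; nra.
Qed.

Lemma ofib_ge m : (m <= ofib m)%N.
Proof.
elim: m => // -[|m] // IH; rewrite -fib_even_odd.
have : (0 < fib m.+1.*2)%N by rewrite doubleS; exact: fib_gt0.
by lia.
Qed.

Lemma covering (t : R) : 1 <= t < g ^+ 2 ->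
  exists m, (ofib m.+1)%:R ^+ 2 / (ofib m)%:R ^+ 2 <= t
     <= (ofib m.+2)%:R ^+ 2 / (ofib m.+1)%:R ^+ 2.
Proof.
move=> /andP[t1 tg].
have o0 m : 0 < (ofib m)%:R :> R by rewrite ltr0n ofib_gt0.
pose P m := t <= (ofib m.+2)%:R ^+ 2 / (ofib m.+1)%:R ^+ 2.
have exP : exists m, P m.
  have [g2 g4] := andP golden_bounds.
  set r := Num.sqrt t; have r0 : 0 <= r by exact: sqrtr_ge0.
  have rt : r ^+ 2 = t by rewrite sqr_sqrtr //; lra.
  have rg : r < g.
    by rewrite -(ltr_pXn2r (ltn0Sn 1)) ?nnegrE ?rt //; lra.
  pose m := (Num.truncn (3 / (g - r))).+1.
  have mP : 3 / (g - r) < m%:R by exact: truncnS_gt.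
  exists m; rewrite /P -expr_div_n -rt lerXn2r ?nnegrE ?divr_ge0 //.
  rewrite ler_pdivlMr //; have /andP[_ d3] := golden_defect m.+1.
  have mo : m%:R <= (ofib m.+1)%:R :> R.
    by rewrite ler_nat (leq_trans (leqnSn m)) // ofib_ge.
  have : 3 <= (g - r) * (ofib m.+1)%:R.
    rewrite mulrC -ler_pdivrMr ?subr_gt0 //; lra.
  rewrite mulrBl; lra.
have [m Pm mmin] := ex_minnP exP.
exists m; rewrite (Pm : _ <= _) andbT; case: m Pm mmin => [|m] _ mmin.
  by rewrite /= !expr1n divr1.
by rewrite leNgt; apply/negP => /ltW /mmin; rewrite ltnn.
Qed.
End GoldenRatio.

Theorem theorem3 (R : realType) :
  let phi : R := (1 + Num.sqrt 5) / 2 in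
  let F (i : int) : R := (fibz i)%:~R in
  [/\ (* the intervals below, for odd i, cover [1, phi^4[ *)
      forall t : R, 1 <= t < phi ^+ 4 ->
        exists2 i : nat, odd i &
          F (i%:Z) ^+ 2 / F (i%:Z - 2) ^+ 2 <= t
            <= F (i%:Z + 2) ^+ 2 / F (i%:Z) ^+ 2,
      forall (i : nat) (t : R), odd i ->
        (F (i%:Z) ^+ 2 / F (i%:Z - 2) ^+ 2 <= t <= F (i%:Z + 2) / F (i%:Z - 2) ->
           mu_hat t = F (i%:Z - 2) / F (i%:Z) * t) /\
        (F (i%:Z + 2) / F (i%:Z - 2) <= t <= F (i%:Z + 2) ^+ 2 / F (i%:Z) ^+ 2 ->
           mu_hat t = F (i%:Z + 2) / F (i%:Z)),
      forall t : R, phi ^+ 4 <= t <= 7 -> mu_hat t = (1 + t) / 3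
    & forall t : R, 7 <= t <= 7 + 1 / 9 -> mu_hat t = 8 / 3].
Proof.
move=> phi F; have phi4 : phi ^+ 4 = (phi ^+ 2) ^+ 2 by rewrite -exprM.
split.
- move=> t; rewrite phi4 => /covering[m tm]; exists m.*2.+1.
    by rewrite /= odd_double.
  by have [e1 e2 e3] := fibz_odd m; rewrite /F e1 e2 e3.
- move=> i t oi; have iE : i = i./2.*2.+1 by rewrite -{1}(odd_double_half i) oi.
  rewrite iE; have [e1 e2 e3] := fibz_odd i./2; rewrite /F e1 e2 e3.
  exact: mu_hat_steps.
- move=> t /andP[t1 t2].
  have [g2 g4] := andP (golden_bounds R); have gE := golden_eq R.
  have t5 : 5 <= t by apply: le_trans t1; rewrite phi4 gE; lra.
  have [->|t7] := eqVneq t 7.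
    apply: mu_hat_nodal; try lra.
    have -> : (1 + 7) / 3 = 8 / 3 :> R by field.
    by apply: (@growth_le_mono R _ _ (64 / 9)); [lra|exact: growth_nodal_end].
  apply: mu_hat_nodal; try lra.
  apply: growth_nodal_lt7.
    by apply/andP; split; [lra|rewrite lt_neqAle t7 t2].
  move: t1 gE g2 g4; rewrite phi4 -/phi; move: (phi ^+ 2) => x xt xE x2 x4.
  by nra.
- move=> t /andP[t1 t2]; apply: mu_hat_nodal; try lra.
  by apply: (@growth_le_mono R _ _ (64 / 9)); [lra|exact: growth_nodal_end].
Qed.
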